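(* Consider the overlapping generations economy described in the context. Let $w=b/a$ be the old-to-young income ratio and let $w_f^*<w_b^*$ be the unique positive numbers satisfying $$\frac{U_y}{U_z}(1,Gw_f^* )=G_d,\qquad \frac{U_y}{U_z}(1,Gw_b^* )=G.$$ Then the following statements are true. (i) If $w>w_f^*$, there exists a unique equilibrium such that $G_d^{-t}P_t$ converges to a positive number, which is fundamental. (ii) If $w<w_b^*$, there exists an equilibrium such that $G^{-t}P_t$ converges to a positive number, which is bubbly. If in addition $w<w_f^*$, there exist no fundamental equilibria. (iii) If $w_f^*<w<w_b^*$, there exist a continuum of equilibria such that $G^{-t}P_t$ converges to zero, which are all bubbly except the unique equilibrium in (i).
   Context: Economy. Time is $t=0,1,2,\dots$. A two-period-lived generation is born each period; generation $t$ has utility $U(y_t,z_{t+1})$ over consumption when young and old. $U:(0,\infty)^2\to(0,\infty)$ is quasi-concave, homogeneous of degree 1, twice continuously differentiable, and satisfies $U_y>0$, $U_z>0$, $U_{yy}<0$, $U_{zz}<0$, $U_y(0,z)=\infty$, $U_z(y,0)=\infty$ (limits at the boundary); subscripts denote partial derivatives. Endowments of the young and old at date $t$ are $(a_t,b_t)=(aG^t,bG^t)$ with $G>0$, $a>0$, $b\ge0$. An infinitely-lived asset in unit supply, initially owned by the old, pays dividend $D_t=DG_d^t$ with $D>0$ and $G_d\in(0,G)$, and trades at ex-dividend price $P_t>0$. Equilibrium. An equilibrium is a sequence $\{(P_t,x_t,y_t,z_t)\}_{t\ge0}$ such that for each $t$ the young choose $x_t$ to maximize $U(y_t,z_{t+1})$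 subject to $y_t+P_tx_t=a_t$ and $z_{t+1}=b_{t+1}+(P_{t+1}+D_{t+1})x_t$, and the markets clear: $x_t=1$ and $y_t+z_t=a_t+b_t+D_t$. Equivalently, $P_t\in(0,a_t)$ and the Euler equation $U_y(y_t,z_{t+1})P_t=U_z(y_t,z_{t+1})(P_{t+1}+D_{t+1})$ holds for all $t$ with $(y_t,z_{t+1})=(a_t-P_t,b_{t+1}+P_{t+1}+D_{t+1})$. Bubble. With $R_t=(P_{t+1}+D_{t+1})/P_t$, $q_0=1$, $q_t=1/\prod_{s=0}^{t-1}R_s$, the fundamental value is $V_t=\frac1{q_t}\sum_{s=t+1}^\infty q_sD_s\le P_t$. An equilibrium is fundamental if $P_t=V_t$ for all $t$ and bubbly if $P_t>V_t$ for all $t$ (one of the two always holds; bubbly is equivalent to $\lim_{T\to\infty}q_TP_T>0$). *)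

(* Defs.v *)
From Stdlib Require Import Reals.
From Coquelicot Require Import Coquelicot.
Open Scope R_scope.

Definition partial_y (f : R -> R -> R) (y z : R) : R := Derive (fun s => f s z) y.
Definition partial_z (f : R -> R -> R) (y z : R) : R := Derive (fun s => f y s) z.

(* [U] is a total function on R x R, but it stands for a function on the open
   positive quadrant: no condition constrains its values elsewhere. *)
Record standard_utility (U : R -> R -> R) : Prop := {
  utility_pos : forall y z, 0 < y -> 0 < z -> 0 < U y z;
  utility_quasiconcave : forall y1 z1 y2 z2 l,
    0 < y1 -> 0 < z1 -> 0 < y2 -> 0 < z2 -> 0 <= l <= 1 ->
    Rmin (U y1 z1) (U y2 z2)
      <= U (l * y1 + (1 - l) * y2) (l * z1 + (1 - l) * z2);
  utility_homogeneous : forall k y z, 0 < k -> 0 < y -> 0 < z ->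
    U (k * y) (k * z) = k * U y z;
  (* All partial derivatives of order at most 2 exist and are continuous, at
     every point of the open quadrant. *)
  utility_C2 : forall y z, 0 < y -> 0 < z -> ex_diff_n U 2 y z;
  utility_y_pos : forall y z, 0 < y -> 0 < z -> 0 < partial_y U y z;
  utility_z_pos : forall y z, 0 < y -> 0 < z -> 0 < partial_z U y z;
  utility_yy_neg : forall y z, 0 < y -> 0 < z ->
    partial_y (partial_y U) y z < 0;
  utility_zz_neg : forall y z, 0 < y -> 0 < z ->
    partial_z (partial_z U) y z < 0;
  utility_y_at_0 : forall z, 0 < z ->
    filterlim (fun y => partial_y U y z) (at_right 0) (Rbar_locally p_infty);
  utility_z_at_0 : forall y, 0 < y ->
    filterlim (fun z => partial_z U y z) (at_right 0) (Rbar_locally p_infty)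
}.

Record economy := {
  util : R -> R -> R;
  G : R;
  Gd : R;
  a : R;
  b : R;
  D : R;
  util_standard : standard_utility util;
  G_pos : 0 < G;
  Gd_pos : 0 < Gd;
  Gd_lt_G : Gd < G;
  a_pos : 0 < a;
  b_nonneg : 0 <= b;
  D_pos : 0 < D
}.

Definition young_endowment (e : economy) (t : nat) : R := a e * G e ^ t.
Definition old_endowment (e : economy) (t : nat) : R := b e * G e ^ t.
Definition dividend (e : economy) (t : nat) : R := D e * Gd e ^ t.

Definition income_ratio (e : economy) : R := b e / a e.

Definition mrs (e : economy) (y z : R) : R :=
  partial_y (util e) y z / partial_z (util e) y z.

Record path := {
  price : nat -> R;
  holding : nat -> R;
  cons_young : nat -> R;
  cons_old : nat -> R
}.

(* Consumption must lie in the domain of the utility function, so it is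
   positive; the asset holding [x] is otherwise unrestricted. *)
Definition budget (e : economy) (P : nat -> R) (t : nat) (x y z : R) : Prop :=
  0 < y /\ 0 < z /\
  y + P t * x = young_endowment e t /\
  z = old_endowment e (S t) + (P (S t) + dividend e (S t)) * x.

Definition optimal_choice (e : economy) (P : nat -> R) (t : nat) (x y z : R) : Prop :=
  budget e P t x y z /\
  forall x' y' z', budget e P t x' y' z' -> util e y' z' <= util e y z.

Definition equilibrium (e : economy) (E : path) : Prop :=
  forall t,
    0 < price E t /\
    optimal_choice e (price E) t
      (holding E t) (cons_young E t) (cons_old E (S t)) /\
    holding E t = 1 /\
    cons_young E t + cons_old E t
      = young_endowment e t + old_endowment e t + dividend e t.

Definition gross_return (e : economy) (P : nat -> R) (t : nat) : R :=
  (P (S t) + dividend e (S t)) / P t.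

Fixpoint date0_price (e : economy) (P : nat -> R) (t : nat) : R :=
  match t with
  | O => 1
  | S s => date0_price e P s / gross_return e P s
  end.

(* The summand of index [k] is the one at date s = t + 1 + k.  For positive
   prices the series converges, its partial sums being increasing and bounded
   by [date0_price e P t * P t], so [Series] is its actual sum. *)
Definition fundamental_value (e : economy) (P : nat -> R) (t : nat) : R :=
  / date0_price e P t *
  Series (fun k => date0_price e P (S t + k) * dividend e (S t + k)).

Definition fundamental (e : economy) (E : path) : Prop :=
  forall t, price E t = fundamental_value e (price E) t.

Definition bubbly (e : economy) (E : path) : Prop :=
  forall t, price E t > fundamental_value e (price E) t.

Definition grows_at_rate (g : R) (E : path) : Prop :=
  exists p : R, 0 < p /\ is_lim_seq (fun t => price E t / g ^ t) p.

Definition negligible_at_rate (g : R) (E : path) : Prop :=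
  is_lim_seq (fun t => price E t / g ^ t) 0.

Definition is_continuum {T : Type} (A : T -> Prop) : Prop :=
  exists f : R -> T,
    (forall r s, f r = f s -> r = s) /\
    (forall E, A E <-> exists r, f r = E).

(* Main.v *)
Require Import Defs.
From Stdlib Require Import Reals Ranalysis5 Lra Lia ClassicalEpsilon FunctionalExtensionality.
From Coquelicot Require Import Coquelicot.
Open Scope R_scope.

(* Let p_t be the price relative to the endowment of the young, d_t = d_0 rho^t
   the dividend so normalised, and s = p_{t+1} + d_{t+1}.  Homogeneity turns the
   Euler equation into m(X) p_t = G s with X = G (w + s) / (1 - p_t), where m(X)
   is the marginal rate of substitution at (1, X).  This determines p_t = phi(s)
   but not s from p_t, so every orbit known from some date on extends uniquely
   back to date 0, and only its tail matters.

   The map phi is strictly differentiable at its fixed points 0 (with slope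
   G / m(G w)) and p* = (w_b - w) / (1 + w_b) (with some slope c, of either sign).
   Orbits tending to p* exist because either |c| rho < 1, and iterating phi
   backwards from p* contracts errors relative to rho^t, or |c| > 1, and the
   local inverse of phi contracts forwards.  At 0, when m(G w) > G_d, the ratio
   p_t / d_t expands: it either tends to its fixed point, which gives the
   unique orbit growing like the dividends, or grows geometrically.  An
   equilibrium is bubbly if and only if sum D_t / P_t is finite. *)

(** * Real sequences and backward orbits *)

(** The obstacle is that [phi] need not be monotone, so only local information at its two fixed
    points is available. What makes it enough is the forcing: errors are weighed against rho^t, so
    any backward slope below 1 / rho still contracts, and the borderline |c| = 1 at p* joins the
    backward case. At 0 the slope is c = G / m(G w), and the two thresholds are conditions on it: w
    > w_f says c < 1 / rho, and w < w_b says c > 1. Between them, 0 is backward stable relative to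
    rho^t and forward stable in absolute terms. The first property yields the orbit proportional to
    dividends, the second an interval of vanishing orbits. For w < w_f the ratio w may vanish, and m
    is controlled only at positive arguments. That case therefore compares with a level X1 slightly
    above G w instead of using a slope at 0. A continuum means an exact bijection with the reals.
    The dynamics give injections in each direction only: a value at one date selects an orbit, and
    an orbit is encoded by one real number. *)

(** Cantor-Bernstein: [f] follows [g] on the reals whose chain starts outside the image of [h], and
    inverts [h] on all other reals. Membership in [C] is undecidable, hence the classical case
    distinction. *)
Lemma exists_bijection_of_injections {T : Type} (A : T -> Prop) (g : R -> T) (h : T -> R) :
  (forall r, A (g r)) ->
  (forall r s, g r = g s -> r = s) ->
  (forall x y, A x -> A y -> h x = h y -> x = y) ->
  exists f : R -> T,
    (forall r s, f r = f s -> r = s) /\ (forall x, A x <-> exists r, f r = x).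
Proof.
  intros gA ginj hinj.
  (* reals whose backward chain under h o g stops outside the image of h *)
  pose (C := fun r => exists n r0, (forall x, A x -> h x <> r0) /\
               r = Nat.iter n (fun u => h (g u)) r0).
  assert (CS : forall r, C r -> C (h (g r))).
  { intros r [n [r0 [H0 Hn]]]. exists (S n), r0. split; [exact H0|].
    simpl. now rewrite Hn. }
  assert (CP : forall r, C (h (g r)) -> C r).
  { intros r [[|n] [r0 [H0 Hn]]].
    - exfalso. apply (H0 (g r)); [apply gA | exact Hn].
    - exists n, r0. split; [exact H0|]. simpl in Hn.
      apply ginj. apply hinj; auto. }
  pose (k := fun r => epsilon (inhabits (g 0)) (fun x => A x /\ h x = r)).
  assert (Hk : forall r, ~ C r -> A (k r) /\ h (k r) = r).
  { intros r Hr. unfold k. apply epsilon_spec.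
    destruct (excluded_middle_informative (exists x, A x /\ h x = r)) as [Hx|Hx]; [exact Hx|].
    exfalso. apply Hr. exists O, r. split; [|reflexivity].
    intros x Ax Hx'. apply Hx. now exists x. }
  exists (fun r => if excluded_middle_informative (C r) then g r else k r).
  split.
  - assert (HD : forall r s, C r -> ~ C s -> g r <> k s).
    { intros r s Cr Cs Hrs. destruct (Hk s Cs) as [_ Hs]. apply Cs.
      rewrite <- Hs, <- Hrs. now apply CS. }
    intros r s.
    destruct (excluded_middle_informative (C r)) as [Cr|Cr];
    destruct (excluded_middle_informative (C s)) as [Cs|Cs]; intros Hrs.
    + now apply ginj.
    + now destruct (HD r s Cr Cs).
    + now destruct (HD s r Cs Cr).
    + destruct (Hk r Cr) as [_ <-]. destruct (Hk s Cs) as [_ <-]. now rewrite Hrs.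
  - intros x. split.
    + intros Ax. destruct (excluded_middle_informative (C (h x))) as [Cx|Cx].
      * destruct Cx as [[|n] [r0 [H0 Hn]]].
        -- destruct (H0 x Ax Hn).
        -- simpl in Hn. set (r := Nat.iter n (fun u => h (g u)) r0) in Hn.
           assert (Cr : C r) by (exists n, r0; now split).
           exists r. destruct (excluded_middle_informative (C r)); [|contradiction].
           symmetry. now apply hinj.
      * exists (h x). destruct (excluded_middle_informative (C (h x))); [contradiction|].
        destruct (Hk _ Cx) as [A1 H1]. now apply hinj.
    + intros [r <-]. destruct (excluded_middle_informative (C r)) as [Cr|Cr]; [apply gA|].
      now apply Hk.
Qed.

Lemma exists_pow_small (q eps : R) : 0 <= q < 1 -> 0 < eps ->
  exists T, forall t, (T <= t)%nat -> q ^ t < eps.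
Proof.
  intros Hq He. destruct (pow_lt_1_zero q) with (y := eps) as [T HT]; [rewrite Rabs_pos_eq; lra|lra|].
  exists T. intros t Ht. specialize (HT t Ht). rewrite Rabs_pos_eq in HT; [lra|].
  apply pow_le; lra.
Qed.

(** Looking n dates ahead costs a factor q^n while the far value stays below [M], so nothing
    positive survives. Applied to deviations divided by the dividend, this yields both uniqueness
    and convergence at 0. *)
Lemma Rle_0_of_bounded_backward_contraction (e : nat -> R) (q M : R) :
  0 <= q < 1 -> (forall t, e t <= q * e (S t)) -> (forall t, e t <= M) -> forall t, e t <= 0.
Proof.
  intros Hq He HM t. apply Rnot_lt_le. intros Hpos.
  assert (Hn : forall n, e t <= q ^ n * Rmax M 0).
  { intros n. apply Rle_trans with (q ^ n * e (t + n)%nat).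
    - induction n as [|n IH]; [simpl; rewrite Nat.add_0_r; lra|].
      apply Rle_trans with (1 := IH). rewrite Nat.add_succ_r. simpl.
      rewrite (Rmult_comm q), Rmult_assoc. apply Rmult_le_compat_l; [apply pow_le; lra|apply He].
    - apply Rmult_le_compat_l; [apply pow_le; lra|].
      apply Rle_trans with (1 := HM _), Rmax_l. }
  assert (HMp : 0 < Rmax M 0 + 1) by (generalize (Rmax_r M 0); lra).
  destruct (exists_pow_small q (e t / (Rmax M 0 + 1)) Hq) as [T HT].
  { now apply Rdiv_lt_0_compat. }
  specialize (HT T (le_n T)). specialize (Hn T).
  apply (Rmult_lt_compat_r _ _ _ HMp) in HT.
  replace (e t / (Rmax M 0 + 1) * (Rmax M 0 + 1)) with (e t) in HT by (field; lra).
  assert (0 <= q ^ T) by (apply pow_le; lra). nra.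
Qed.

Definition geom (d0 rho : R) (t : nat) : R := d0 * rho ^ t.

Lemma geom_S d0 rho t : geom d0 rho (S t) = rho * geom d0 rho t.
Proof. unfold geom. simpl. ring. Qed.

Lemma geom_pos d0 rho t : 0 < d0 -> 0 < rho -> 0 < geom d0 rho t.
Proof. intros. apply Rmult_lt_0_compat; [assumption | now apply pow_lt]. Qed.

Lemma geom_small d0 rho eps : 0 < d0 -> 0 < rho < 1 -> 0 < eps ->
  exists T, forall t, (T <= t)%nat -> geom d0 rho t < eps.
Proof.
  intros Hd Hr He. destruct (exists_pow_small rho (eps / d0)) as [T HT]; [lra|now apply Rdiv_lt_0_compat|].
  exists T. intros t Ht. specialize (HT t Ht). unfold geom.
  apply (Rmult_lt_compat_l d0) in HT; [|lra].
  replace (d0 * (eps / d0)) with eps in HT by (field; lra). lra.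
Qed.

Lemma is_lim_seq_of_geom_bound (p : nat -> R) (x0 C q : R) (T : nat) :
  0 < q < 1 -> 0 < C -> (forall t, (T <= t)%nat -> Rabs (p t - x0) <= geom C q t) ->
  is_lim_seq p x0.
Proof.
  intros Hq HC H. apply is_lim_seq_spec. intros [eps He]. simpl.
  destruct (geom_small C q eps) as [T' HT']; try lra.
  exists (max T T'). intros t Ht.
  apply Rle_lt_trans with (1 := H t ltac:(lia)). apply HT'. lia.
Qed.

Definition orbit_from (phi : R -> R) (d : nat -> R) (T : nat) (p : nat -> R) : Prop :=
  forall t, (T <= t)%nat -> 0 < p t /\ p t = phi (p (S t) + d (S t)).

Lemma orbit_extend phi d T p :
  (forall s, 0 < s -> 0 < phi s) -> (forall t, 0 < d t) -> orbit_from phi d T p ->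
  exists q, orbit_from phi d 0 q /\ forall t, (T <= t)%nat -> q t = p t.
Proof.
  intros Hphi Hd. revert p. induction T as [|T IH]; intros p Hp; [now exists p|].
  pose (p' := fun t => if Nat.eq_dec t T then phi (p (S T) + d (S T)) else p t).
  destruct (IH p') as [q [Hq Hqp]].
  - intros t Ht. unfold p'. destruct (Nat.eq_dec (S t) T) as [|_]; [lia|].
    destruct (Nat.eq_dec t T) as [->|Ht'].
    + split; [|reflexivity]. apply Hphi. generalize (Hd (S T)) (proj1 (Hp (S T) (le_n _))). lra.
    + apply Hp. lia.
  - exists q. split; [exact Hq|]. intros t Ht. rewrite Hqp; [|lia]. unfold p'.
    destruct (Nat.eq_dec t T); [lia|reflexivity].
Qed.

Lemma orbit_eq_of_tail phi d p q T :
  orbit_from phi d 0 p -> orbit_from phi d 0 q -> (forall t, (T <= t)%nat -> p t = q t) ->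
  forall t, p t = q t.
Proof.
  intros Hp Hq. induction T as [|T IH]; intros H t; [apply H; lia|].
  apply IH. intros u Hu. destruct (Nat.eq_dec u T) as [->|]; [|apply H; lia].
  rewrite (proj2 (Hp T (Nat.le_0_l _))), (proj2 (Hq T (Nat.le_0_l _))), H; [reflexivity|lia].
Qed.

(** * Backward recursions with geometrically decaying forcing *)

Section Decay.
Variables (phi : R -> R) (d0 rho : R).
Hypothesis d0_pos : 0 < d0.
Hypothesis rho_bounds : 0 < rho < 1.
Hypothesis phi_pos : forall s, 0 < s -> 0 < phi s.
Let d := geom d0 rho.

Let d_pos t : 0 < d t.
Proof. apply geom_pos; tauto. Qed.

Let d_lim : is_lim_seq d 0.
Proof.
  apply is_lim_seq_of_geom_bound with d0 rho O; auto.
  intros t _. rewrite Rminus_0_r, Rabs_pos_eq; [apply Rle_refl|]. apply Rlt_le, d_pos.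
Qed.

(** In the norm sup |p_t - x0| / rho^t the backward map contracts with factor [K * rho], even if [K]
    itself exceeds 1. The orbit is the limit of its iterates started from the constant [x0]. *)
Lemma orbit_near_backward_stable_point (x0 K delta : R) :
  0 <= x0 -> phi x0 = x0 -> 0 < K -> K * rho < 1 -> 0 < delta ->
  (forall x y, 0 <= x -> 0 <= y -> Rabs (x - x0) <= delta -> Rabs (y - x0) <= delta ->
     Rabs (phi x - phi y) <= K * Rabs (x - y)) ->
  (forall s, 0 <= s -> 0 <= phi s) ->
  exists T C p, 0 < C /\ orbit_from phi d T p /\
    forall t, (T <= t)%nat -> Rabs (p t - x0) <= geom C rho t.
Proof.
  intros Hx0 Hfix HK HKr Hdelta Hlip Hnn.
  (* [C] solves K rho (C + d0) = C: the weighted ball of this radius is mapped into itself, forcing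
     included. *)
  set (C := K * d0 * rho / (1 - K * rho)).
  assert (HC : 0 < C).
  { unfold C. apply Rdiv_lt_0_compat; [|lra]. repeat apply Rmult_lt_0_compat; tauto. }
  assert (HCe : K * (rho * (C + d0)) = C) by (unfold C; field; lra).
  destruct (geom_small (C + d0) rho delta) as [T HT]; try lra.
  (* [P n t] is the value at date t of the orbit that sits exactly at [x0] at date t + n. *)
  pose (P := fix P (n : nat) (t : nat) : R := match n with O => x0
             | S n => phi (P n (S t) + d (S t)) end).
  assert (Hclose : forall x t, (T <= t)%nat -> Rabs (x - x0) <= geom C rho (S t) ->
            Rabs (x + d (S t) - x0) <= rho * (C + d0) * rho ^ t /\ Rabs (x + d (S t) - x0) <= delta).
  { intros x t Ht Hx.
    assert (H1 : Rabs (x + d (S t) - x0) <= geom (C + d0) rho (S t)).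
    { replace (x + d (S t) - x0) with (x - x0 + d (S t)) by ring.
      apply Rle_trans with (1 := Rabs_triang _ _).
      rewrite (Rabs_pos_eq (d (S t))); [|apply Rlt_le, d_pos].
      unfold d, geom in *. lra. }
    split; [unfold geom in H1; simpl in H1; lra|].
    apply Rle_trans with (1 := H1), Rlt_le, HT. lia. }
  assert (Hnnd : forall x t, 0 <= x -> 0 <= x + d t) by (intros x t Hx; generalize (d_pos t); lra).
  assert (HP : forall n t, (T <= t)%nat -> 0 <= P n t /\ Rabs (P n t - x0) <= geom C rho t).
  { induction n as [|n IH]; intros t Ht; simpl.
    - rewrite Rminus_diag_eq, Rabs_R0 by reflexivity. split; [exact Hx0|].
      apply Rlt_le, geom_pos; tauto.
    - destruct (IH (S t)) as [I1 I2]; [lia|]. split; [apply Hnn; auto|].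
      destruct (Hclose (P n (S t)) t Ht I2) as [J1 J2].
      rewrite <- Hfix at 1. apply Rle_trans with (1 := Hlip (P n (S t) + d (S t)) x0 (Hnnd _ _ I1) Hx0 J2 ltac:(rewrite Rminus_diag_eq, Rabs_R0 by reflexivity; lra)).
      unfold geom. rewrite <- HCe at 1.
      rewrite Rmult_assoc. apply Rmult_le_compat_l; lra. }
  assert (Hstep : forall n t, (T <= t)%nat -> Rabs (P (S n) t - P n t) <= (K * rho) ^ n * geom C rho t).
  { induction n as [|n IH]; intros t Ht.
    - rewrite pow_O, Rmult_1_l. apply (proj2 (HP 1%nat t Ht)).
    - change (P (S (S n)) t) with (phi (P (S n) (S t) + d (S t))).
      change (P (S n) t) with (phi (P n (S t) + d (S t))).
      destruct (HP (S n) (S t)) as [A1 A2]; [lia|]. destruct (HP n (S t)) as [B1 B2]; [lia|].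
      eapply Rle_trans.
      { apply Hlip; auto; apply Hclose; auto. }
      replace (P (S n) (S t) + d (S t) - (P n (S t) + d (S t))) with (P (S n) (S t) - P n (S t)) by ring.
      specialize (IH (S t) ltac:(lia)). rewrite geom_S in IH. simpl pow.
      apply (Rmult_le_compat_l K) in IH; [|lra]. lra. }
  assert (Hlim : forall t, (T <= t)%nat -> ex_finite_lim_seq (fun n => P n t)).
  { intros t Ht.
    assert (Hs : ex_series (fun n => P (S n) t - P n t)).
    { apply @ex_series_le with (b := fun n => scal (geom C rho t) ((K * rho) ^ n)).
      - intros n. change (Rabs (P (S n) t - P n t) <= geom C rho t * (K * rho) ^ n).
        rewrite Rmult_comm. now apply Hstep.
      - apply @ex_series_scal_l, ex_series_geom. rewrite Rabs_pos_eq; [lra|].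
        apply Rmult_le_pos; lra. }
    destruct Hs as [l Hl]. exists (x0 + l).
    apply is_lim_seq_incr_1.
    apply is_lim_seq_ext with (fun n => x0 + sum_n (fun n => P (S n) t - P n t) n).
    { induction n as [|n IH].
      - rewrite sum_O. simpl. ring.
      - rewrite sum_Sn. unfold plus. simpl plus. rewrite <- Rplus_assoc, IH.
        change (P (S n) t + (P (S (S n)) t - P (S n) t) = P (S (S n)) t). ring. }
    apply (is_lim_seq_plus' _ _ x0 l); [apply is_lim_seq_const|exact Hl]. }
  set (p := fun t => real (Lim_seq (fun n => P n t))).
  assert (Hp : forall t, (T <= t)%nat -> is_lim_seq (fun n => P n t) (p t)).
  { intros t Ht. apply Lim_seq_correct', Hlim, Ht. }
  assert (Hpx : forall t, (T <= t)%nat -> Rabs (p t - x0) <= geom C rho t).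
  { intros t Ht.
    assert (HA : is_lim_seq (fun n => Rabs (P n t - x0)) (Rabs (p t - x0))).
    { apply (is_lim_seq_abs _ (Finite (p t - x0))).
      apply is_lim_seq_minus'; [now apply Hp | apply is_lim_seq_const]. }
    apply (is_lim_seq_le (fun n => Rabs (P n t - x0)) (fun _ => geom C rho t)
             (Rabs (p t - x0)) (geom C rho t)); auto; [|apply is_lim_seq_const].
    intros n. now apply HP. }
  assert (Hp0 : forall t, (T <= t)%nat -> 0 <= p t).
  { intros t Ht. apply (is_lim_seq_le (fun n => 0) (fun n => P n t) 0 (p t)); auto; [|apply is_lim_seq_const].
    intros n. now apply HP. }
  assert (Heq : forall t, (T <= t)%nat -> p t = phi (p (S t) + d (S t))).
  { intros t Ht.
    assert (L1 : is_lim_seq (fun n => P (S n) t) (phi (p (S t) + d (S t)))).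
    { apply is_lim_seq_spec. intros [eps He]. simpl.
      assert (HS := Hp (S t) ltac:(lia)). apply is_lim_seq_spec in HS.
      assert (HeK : 0 < eps / K) by (apply Rdiv_lt_0_compat; lra).
      destruct (HS (mkposreal _ HeK)) as [N HN]. exists N. intros n Hn. specialize (HN n Hn). simpl in HN.
      destruct (HP n (S t)) as [B1 B2]; [lia|].
      eapply Rle_lt_trans.
      { apply Hlip; auto; apply Hclose; auto. }
      replace (P n (S t) + d (S t) - (p (S t) + d (S t))) with (P n (S t) - p (S t)) by ring.
      apply (Rmult_lt_compat_l K) in HN; [|lra].
      replace (K * (eps / K)) with eps in HN by (field; lra). exact HN. }
    assert (L2 := proj1 (is_lim_seq_incr_1 _ _) (Hp t Ht)).
    apply is_lim_seq_unique in L1. apply is_lim_seq_unique in L2. rewrite L1 in L2. now injection L2. }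
  exists T, C, p. split; [exact HC|]. split; [|exact Hpx].
  intros t Ht. split; [|now apply Heq].
  (* The limit is only known to be nonnegative; strict positivity returns through the forcing, since
     the argument of [phi] is at least [d (S t)]. *)
  rewrite Heq by exact Ht. apply phi_pos. generalize (Hp0 (S t) ltac:(lia)) (d_pos (S t)). lra.
Qed.

(** A local right inverse of [phi] that contracts towards [x0] is iterated forwards, starting at
    [x0] itself; each step subtracts a dividend, and these perturbations die out. *)
Lemma orbit_near_forward_stable_point (x0 theta delta : R) :
  0 < x0 -> 0 <= theta < 1 -> 0 < delta ->
  (forall p, Rabs (p - x0) <= delta -> exists s, Rabs (s - x0) <= theta * Rabs (p - x0) /\ phi s = p) ->
  exists T p, orbit_from phi d T p /\ is_lim_seq p x0.
Proof.
  intros Hx0 Hth Hdelta Hpre.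
  (* The rate [q] exceeds both the contraction factor and the decay rate of the forcing. The
     constant [C] below solves theta C + d0 rho = C q, which makes the bound C q^t reproduce
     itself. *)
  set (q := (1 + Rmax theta rho) / 2).
  assert (Hq : theta < q /\ rho < q /\ 0 < q < 1).
  { unfold q. generalize (Rmax_l theta rho) (Rmax_r theta rho).
    assert (Rmax theta rho < 1) by (apply Rmax_lub_lt; lra). lra. }
  set (C := d0 * rho / (q - theta)).
  assert (HC : 0 < C) by (apply Rdiv_lt_0_compat; [apply Rmult_lt_0_compat|]; lra).
  assert (HCe : theta * C + d0 * rho = C * q) by (unfold C; field; lra).
  destruct (geom_small C q (Rmin delta x0)) as [T HT]; try lra.
  { apply Rmin_glb_lt; lra. }
  pose (psi := fun p => epsilon (inhabits 0) (fun s => Rabs (s - x0) <= theta * Rabs (p - x0) /\ phi s = p)).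
  assert (Hpsi : forall p, Rabs (p - x0) <= delta -> Rabs (psi p - x0) <= theta * Rabs (p - x0) /\ phi (psi p) = p).
  { intros p Hp. unfold psi. apply epsilon_spec. now apply Hpre. }
  pose (Q := fix Q (n : nat) : R := match n with O => x0 | S n => psi (Q n) - d (T + S n)%nat end).
  assert (HQ : forall n, Rabs (Q n - x0) <= geom C q (T + n)).
  { induction n as [|n IH].
    - simpl. rewrite Rminus_diag_eq, Rabs_R0 by reflexivity. apply Rlt_le, geom_pos; lra.
    - assert (Hd : Rabs (Q n - x0) <= delta).
      { apply Rle_trans with (1 := IH). apply Rlt_le. apply Rlt_le_trans with (1 := HT (T + n)%nat ltac:(lia)), Rmin_l. }
      destruct (Hpsi _ Hd) as [H1 _].
      change (Q (S n)) with (psi (Q n) - d (T + S n)%nat).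
      replace (psi (Q n) - d (T + S n)%nat - x0) with (psi (Q n) - x0 - d (T + S n)%nat) by ring.
      unfold Rminus at 1. apply Rle_trans with (1 := Rabs_triang _ _).
      rewrite Rabs_Ropp, (Rabs_pos_eq (d _)); [|apply Rlt_le, d_pos].
      rewrite Nat.add_succ_r. unfold d. rewrite !geom_S.
      assert (theta * Rabs (Q n - x0) <= theta * geom C q (T + n)) by (apply Rmult_le_compat_l; lra).
      assert (rho ^ (T + n) <= q ^ (T + n)) by (apply pow_incr; lra).
      unfold geom in *.
      apply Rle_trans with (theta * (C * q ^ (T + n)) + d0 * rho * q ^ (T + n)).
      + assert (d0 * rho * rho ^ (T + n) <= d0 * rho * q ^ (T + n)).
        { apply Rmult_le_compat_l; [apply Rmult_le_pos; lra|lra]. }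
        lra.
      + right. replace (q * (C * q ^ (T + n))) with (C * q * q ^ (T + n)) by ring. rewrite <- HCe. ring. }
  assert (Hlt : forall n, geom C q (T + n) < Rmin delta x0) by (intros n; apply HT; lia).
  exists T, (fun t => Q (t - T)%nat). split.
  - intros t Ht. assert (B := HQ (t - T)%nat). assert (B' := Hlt (t - T)%nat). split.
    + apply Rabs_le_between in B. generalize (Rmin_r delta x0). lra.
    + replace (S t - T)%nat with (S (t - T))%nat by lia.
      change (Q (S (t - T))%nat) with (psi (Q (t - T)%nat) - d (T + S (t - T))%nat).
      replace (T + S (t - T))%nat with (S t) by lia.
      replace (psi (Q (t - T)%nat) - d (S t) + d (S t)) with (psi (Q (t - T)%nat)) by ring.
      symmetry. apply Hpsi. generalize (Rmin_l delta x0). lra.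
  - apply is_lim_seq_of_geom_bound with C q T; try lra.
    intros t Ht. assert (B := HQ (t - T)%nat). replace (T + (t - T))%nat with t in B by lia. exact B.
Qed.

(** The quotient involves two moving points, so one slope controls Lipschitz constants and
    injectivity on a whole neighbourhood. Arguments are kept nonnegative so that the boundary point
    0 is covered. *)
Definition strict_derivative (x0 c : R) : Prop :=
  forall eps, 0 < eps -> exists delta, 0 < delta /\
    forall x y, 0 <= x -> 0 <= y -> Rabs (x - x0) <= delta -> Rabs (y - x0) <= delta ->
      Rabs (phi x - phi y - c * (x - y)) <= eps * Rabs (x - y).

Lemma strict_derivative_lipschitz x0 c L : strict_derivative x0 c -> Rabs c < L ->
  exists delta, 0 < delta /\
    forall x y, 0 <= x -> 0 <= y -> Rabs (x - x0) <= delta -> Rabs (y - x0) <= delta ->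
      Rabs (phi x - phi y) <= L * Rabs (x - y).
Proof.
  intros H HL. destruct (H (L - Rabs c)) as [delta [Hd Hb]]; [lra|].
  exists delta. split; [exact Hd|]. intros x y Hx Hy Hx' Hy'.
  replace (phi x - phi y) with (phi x - phi y - c * (x - y) + c * (x - y)) by ring.
  apply Rle_trans with (1 := Rabs_triang _ _). rewrite (Rabs_mult c).
  specialize (Hb x y Hx Hy Hx' Hy'). lra.
Qed.

Lemma lipschitz_continuity_pt (L delta x0 x : R) :
  0 < L -> 0 < x -> Rabs (x - x0) < delta ->
  (forall x y, 0 <= x -> 0 <= y -> Rabs (x - x0) <= delta -> Rabs (y - x0) <= delta ->
      Rabs (phi x - phi y) <= L * Rabs (x - y)) ->
  continuity_pt phi x.
Proof.
  intros HL Hx Hxd H. apply continuity_pt_locally. intros [eps He]. simpl.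
  assert (Hr : 0 < Rmin (Rmin x (delta - Rabs (x - x0))) (eps / L)).
  { repeat apply Rmin_glb_lt; try lra. apply Rdiv_lt_0_compat; lra. }
  exists (mkposreal _ Hr). intros y Hy. change (Rabs (y - x) < Rmin (Rmin x (delta - Rabs (x - x0))) (eps / L)) in Hy.
  assert (H1 := Rlt_le_trans _ _ _ Hy (Rmin_l _ _)). assert (H2 := Rlt_le_trans _ _ _ Hy (Rmin_r _ _)).
  assert (H3 := Rlt_le_trans _ _ _ H1 (Rmin_l _ _)). assert (H4 := Rlt_le_trans _ _ _ H1 (Rmin_r _ _)).
  eapply Rle_lt_trans.
  - apply H; try lra.
    + apply Rabs_lt_between in H3. lra.
    + replace (y - x0) with (y - x + (x - x0)) by ring.
      apply Rle_trans with (1 := Rabs_triang _ _). lra.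
  - apply (Rmult_lt_compat_l L) in H2; [|lra]. replace (L * (eps / L)) with eps in H2 by (field; lra). exact H2.
Qed.

Lemma orbit_converging_to_fixed_point x0 c :
  0 < x0 -> phi x0 = x0 -> strict_derivative x0 c ->
  (forall s, 0 <= s -> 0 <= phi s) ->
  exists T p, orbit_from phi d T p /\ is_lim_seq p x0.
Proof.
  intros Hx0 Hfix Hc Hnn. destruct (Rle_lt_dec (Rabs c) 1) as [Hc1|Hc1].
  (* The midpoint of 1 and 1 / rho: above |c|, yet with [K * rho] below 1. *)
  - set (K := (1 + / rho) / 2).
    assert (1 < / rho) by (rewrite <- Rinv_1; apply Rinv_lt_contravar; lra).
    assert (HKr : K * rho < 1) by (unfold K; replace ((1 + / rho) / 2 * rho) with ((rho + 1) / 2) by (field; lra); lra).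
    destruct (strict_derivative_lipschitz x0 c K Hc) as [delta [Hd HL]]; [unfold K; lra|].
    destruct (orbit_near_backward_stable_point x0 K delta) as [T [C [p [HC [Hp Hpx]]]]]; auto; try (unfold K; lra).
    exists T, p. split; [exact Hp|]. now apply is_lim_seq_of_geom_bound with C rho T.
  (* [g] lies strictly between 1 and |c|, and [theta] strictly between 1 / g and 1; their product
     exceeds 1, which leaves room to bracket a preimage. *)
  - set (g := (Rabs c + 1) / 2). set (theta := (1 + / g) / 2).
    assert (Hg : 1 < g < Rabs c) by (unfold g; lra).
    assert (Hig : / g < 1) by (rewrite <- Rinv_1; apply Rinv_lt_contravar; lra).
    assert (0 < / g) by (apply Rinv_0_lt_compat; lra).
    assert (Htg : 1 < theta * g) by (unfold theta; replace ((1 + / g) / 2 * g) with ((g + 1) / 2) by (field; lra); lra).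
    destruct (Hc (Rabs c - g)) as [d1 [Hd1 H1]]; [lra|].
    destruct (strict_derivative_lipschitz x0 c (Rabs c + 1) Hc) as [d2 [Hd2 H2]]; [lra|].
    set (delta := Rmin (Rmin d1 (d2 / 2)) (x0 / 2)).
    assert (Hdelta : 0 < delta /\ delta <= d1 /\ delta <= d2 / 2 /\ delta <= x0 / 2).
    { unfold delta. generalize (Rmin_l (Rmin d1 (d2 / 2)) (x0 / 2)) (Rmin_r (Rmin d1 (d2 / 2)) (x0 / 2)).
      generalize (Rmin_l d1 (d2 / 2)) (Rmin_r d1 (d2 / 2)). intros. repeat split; try lra.
      repeat apply Rmin_glb_lt; lra. }
    apply orbit_near_forward_stable_point with theta delta; try lra; [unfold theta; lra|].
    intros p Hp. destruct (Req_dec p x0) as [->|Hpx].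
    { exists x0. rewrite Rminus_diag_eq, Rabs_R0 by reflexivity. split; [lra|exact Hfix]. }
    set (h := theta * Rabs (p - x0)).
    assert (Habs : 0 < Rabs (p - x0)) by (apply Rabs_pos_lt; lra).
    assert (Hth : 0 < theta < 1) by (unfold theta; lra).
    assert (Hh : 0 < h < delta) by (unfold h; split; [apply Rmult_lt_0_compat|]; nra).
    assert (Hgh : Rabs (p - x0) < g * h) by (unfold h; nra).
    assert (Hcont : forall u, x0 - h <= u <= x0 + h -> continuity_pt phi u).
    { intros u Hu. apply lipschitz_continuity_pt with (Rabs c + 1) d2 x0; auto; try lra.
      apply Rabs_lt_between. lra. }
    assert (Hpl : Rabs (phi (x0 + h) - x0 - c * h) <= (Rabs c - g) * h).
    { specialize (H1 (x0 + h) x0). rewrite Hfix in H1.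
      replace (x0 + h - x0) with h in H1 by ring. rewrite (Rabs_pos_eq h) in H1 by lra.
      replace (x0 - x0) with 0 in H1 by ring. rewrite Rabs_R0 in H1. apply H1; lra. }
    assert (Hmi : Rabs (phi (x0 - h) - x0 - c * - h) <= (Rabs c - g) * h).
    { specialize (H1 (x0 - h) x0). rewrite Hfix in H1.
      replace (x0 - h - x0) with (- h) in H1 by ring. rewrite Rabs_Ropp, (Rabs_pos_eq h) in H1 by lra.
      replace (x0 - x0) with 0 in H1 by ring. rewrite Rabs_R0 in H1. apply H1; lra. }
    apply Rabs_le_between in Hpl. apply Rabs_le_between in Hmi. apply Rabs_lt_between in Hgh.
    (* At x0 - h and x0 + h the values of [phi] have moved by at least g h, more than |p - x0|, on
       opposite sides of [x0]. The sign of [c] only decides the orientation. *)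
    assert (Hex : exists u, x0 - h <= u <= x0 + h /\ phi u = p).
    { destruct (Rle_lt_dec 0 c) as [Hcs|Hcs].
      - rewrite (Rabs_pos_eq c) in * by lra.
        destruct (IVT_interv (fun u => phi u - p) (x0 - h) (x0 + h)) as [u [Hu Hu']]; try lra.
        + intros u Hu. apply continuity_pt_minus; [now apply Hcont|now apply continuity_pt_const].
        + exists u. split; [exact Hu|lra].
      - rewrite (Rabs_left c) in * by lra.
        destruct (IVT_interv (fun u => p - phi u) (x0 - h) (x0 + h)) as [u [Hu Hu']]; try lra.
        + intros u Hu. apply continuity_pt_minus; [now apply continuity_pt_const|now apply Hcont].
        + exists u. split; [exact Hu|lra]. }
    destruct Hex as [u [Hu Hpu]]. exists u. split; [|exact Hpu].
    apply Rabs_le_between. fold h. lra.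
Qed.

(** * Orbits near the fixed point 0, measured against dividends *)

Section AtZero.
Variable c : R.
Hypothesis phi_0 : phi 0 = 0.
Hypothesis phi_nonneg : forall s, 0 <= s -> 0 <= phi s.
Hypothesis c_pos : 0 < c.
Hypothesis c_rho_lt_1 : c * rho < 1.
Hypothesis phi_deriv_0 : strict_derivative 0 c.

Let exists_slope : exists K, c < K /\ K * rho < 1.
Proof.
  exists ((c + / rho) / 2).
  assert (c < / rho).
  { apply Rmult_lt_reg_r with rho; [tauto|]. rewrite Rinv_l; lra. }
  split; [lra|]. replace ((c + / rho) / 2 * rho) with ((c * rho + 1) / 2) by (field; lra). lra.
Qed.

Lemma orbit_proportional_to_decay :
  exists M p, orbit_from phi d 0 p /\ exists T, forall t, (T <= t)%nat -> p t <= M * d t.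
Proof.
  destruct exists_slope as [K [HcK HK]].
  destruct (strict_derivative_lipschitz 0 c K phi_deriv_0) as [delta [Hd HL]]; [rewrite Rabs_pos_eq; lra|].
  destruct (orbit_near_backward_stable_point 0 K delta) as [T [C [p [HC [Hp Hpx]]]]]; auto; try lra.
  destruct (orbit_extend phi d T p) as [q [Hq Hqp]]; auto.
  exists (C / d0), q. split; [exact Hq|]. exists T. intros t Ht. rewrite Hqp by exact Ht.
  specialize (Hpx t Ht). rewrite Rminus_0_r in Hpx. apply Rle_trans with (1 := Rle_abs _).
  apply Rle_trans with (1 := Hpx). right. unfold d, geom. field. lra.
Qed.

(** The gap between the two orbits, divided by [d], is bounded by 2 M and contracts backwards with
    factor [K * rho], so it vanishes from a late date on; the recursion carries equality back to
    date 0. *)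
Lemma orbit_proportional_to_decay_unique M p q T :
  orbit_from phi d 0 p -> orbit_from phi d 0 q ->
  (forall t, (T <= t)%nat -> p t <= M * d t) -> (forall t, (T <= t)%nat -> q t <= M * d t) ->
  forall t, p t = q t.
Proof.
  intros Hp Hq HpM HqM.
  destruct exists_slope as [K [HcK HK]].
  destruct (strict_derivative_lipschitz 0 c K phi_deriv_0) as [delta [Hd HL]]; [rewrite Rabs_pos_eq; lra|].
  assert (HM : 0 < M).
  { generalize (HpM T (le_n _)) (proj1 (Hp T (Nat.le_0_l _))) (d_pos T). intros. nra. }
  destruct (geom_small d0 rho (delta / (M + 1))) as [T' HT']; try lra.
  { apply Rdiv_lt_0_compat; lra. }
  assert (Hsmall : forall x t, (T' <= t)%nat -> 0 < x -> x <= M * d t -> Rabs (x + d t - 0) <= delta).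
  { intros x t Ht Hx HxM. specialize (HT' t Ht). fold (d t) in HT'.
    generalize (d_pos t). intros. rewrite Rminus_0_r, Rabs_pos_eq by lra.
    apply (Rmult_lt_compat_r (M + 1)) in HT'; [|lra].
    replace (delta / (M + 1) * (M + 1)) with delta in HT' by (field; lra). lra. }
  apply orbit_eq_of_tail with phi d (T + T')%nat; auto.
  set (N := (T + T')%nat).
  assert (He : forall n, Rabs (p (N + n)%nat - q (N + n)%nat) / d (N + n)%nat <= 0).
  { apply Rle_0_of_bounded_backward_contraction with (K * rho) (2 * M).
    - split; [apply Rmult_le_pos; lra|lra].
    - intros n. rewrite Nat.add_succ_r. set (t := (N + n)%nat).
      destruct (Hp t (Nat.le_0_l _)) as [_ ->]. destruct (Hq t (Nat.le_0_l _)) as [_ ->].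
      assert (A1 := proj1 (Hp (S t) (Nat.le_0_l _))). assert (A2 := proj1 (Hq (S t) (Nat.le_0_l _))).
      assert (A3 := d_pos (S t)). assert (A4 := d_pos t).
      assert (HLt := HL (p (S t) + d (S t)) (q (S t) + d (S t)) ltac:(lra) ltac:(lra)).
      replace (p (S t) + d (S t) - (q (S t) + d (S t))) with (p (S t) - q (S t)) in HLt by ring.
      apply Rmult_le_reg_r with (d t); [exact A4|].
      replace (Rabs (phi (p (S t) + d (S t)) - phi (q (S t) + d (S t))) / d t * d t)
        with (Rabs (phi (p (S t) + d (S t)) - phi (q (S t) + d (S t)))) by (field; lra).
      replace (K * rho * (Rabs (p (S t) - q (S t)) / d (S t)) * d t) with (K * Rabs (p (S t) - q (S t))).
      2:{ unfold d. rewrite geom_S. fold d. field. fold (d t). split; lra. }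
      apply HLt; apply Hsmall; try lra; try (apply HpM || apply HqM); unfold t, N; lia.
    - intros n. set (t := (N + n)%nat).
      assert (A1 := proj1 (Hp t (Nat.le_0_l _))). assert (A2 := proj1 (Hq t (Nat.le_0_l _))).
      assert (A3 := HpM t ltac:(unfold t, N; lia)). assert (A4 := HqM t ltac:(unfold t, N; lia)).
      assert (A5 := d_pos t).
      apply Rmult_le_reg_r with (d t); [exact A5|].
      replace (Rabs (p t - q t) / d t * d t) with (Rabs (p t - q t)) by (field; lra).
      apply Rabs_le_between. lra. }
  intros t Ht. specialize (He (t - N)%nat). replace (N + (t - N))%nat with t in He by lia.
  assert (A := d_pos t).
  assert (Rabs (p t - q t) <= 0).
  { apply (Rmult_le_compat_r (d t)) in He; [|lra].
    replace (Rabs (p t - q t) / d t * d t) with (Rabs (p t - q t)) in He by (field; lra). lra. }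
  generalize (Rabs_pos (p t - q t)) (Rle_abs (p t - q t)) (Rle_abs (- (p t - q t))).
  rewrite Rabs_Ropp. lra.
Qed.

Let small_from (p : nat -> R) (delta : R) : is_lim_seq p 0 -> 0 < delta ->
  exists T, forall t, (T <= t)%nat -> p t + d t < delta.
Proof.
  intros Hp Hd. assert (H := is_lim_seq_plus' _ _ _ _ Hp d_lim). rewrite Rplus_0_r in H.
  apply is_lim_seq_spec in H. destruct (H (mkposreal _ Hd)) as [T HT].
  exists T. intros t Ht. specialize (HT t Ht). simpl in HT. rewrite Rminus_0_r in HT.
  apply Rle_lt_trans with (1 := Rle_abs _), HT.
Qed.

(** To first order the ratio x_t = p_t / d_t satisfies x_t = k (x_{t+1} + 1) with k = c rho, whose
    fixed point is k / (1 - k). The deviation from it contracts backwards up to the linearisation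
    error. *)
Lemma orbit_decay_ratio_limit M p T :
  orbit_from phi d 0 p -> (forall t, (T <= t)%nat -> p t <= M * d t) ->
  is_lim_seq (fun t => p t / d t) (c * rho / (1 - c * rho)).
Proof.
  intros Hp HpM. set (k := c * rho). set (v := k / (1 - k)).
  assert (Hk : 0 < k < 1) by (unfold k; split; [apply Rmult_lt_0_compat|]; lra).
  assert (Hv : v = k * (v + 1)) by (unfold v; field; lra).
  assert (Hv0 : 0 < v) by (apply Rdiv_lt_0_compat; lra).
  assert (HM : 0 < M).
  { generalize (HpM T (le_n _)) (proj1 (Hp T (Nat.le_0_l _))) (d_pos T). intros. nra. }
  assert (Hp0 : is_lim_seq p 0).
  { apply is_lim_seq_of_geom_bound with (M * d0) rho T; auto; [now apply Rmult_lt_0_compat|].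
    intros t Ht. rewrite Rminus_0_r, Rabs_pos_eq; [|apply Rlt_le, Hp; lia].
    apply Rle_trans with (1 := HpM t Ht). unfold d, geom. lra. }
  apply is_lim_seq_spec. intros [eps Heps]. simpl.
  (* The linearisation error per date is at most eta rho (M + 1); summed with weights k^n it amounts
     to exactly eps / 2. *)
  set (eta := eps * (1 - k) / (2 * rho * (M + 1))).
  assert (Heta : 0 < eta).
  { apply Rdiv_lt_0_compat; repeat apply Rmult_lt_0_compat; lra. }
  assert (Hetae : eta * rho * (M + 1) = (1 - k) * (eps / 2)) by (unfold eta; field; lra).
  destruct (phi_deriv_0 eta Heta) as [delta [Hd Hb]].
  destruct (small_from p delta Hp0 Hd) as [T' HT'].
  set (N := (T + T')%nat).
  assert (He : forall n, Rabs (p (N + n)%nat / d (N + n)%nat - v) - eps / 2 <= 0).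
  { apply Rle_0_of_bounded_backward_contraction with k (M + v).
    - lra.
    - intros n. rewrite Nat.add_succ_r. set (t := (N + n)%nat).
      assert (A1 := proj1 (Hp (S t) (Nat.le_0_l _))).
      assert (A3 := d_pos (S t)). assert (A4 := d_pos t).
      assert (HpS := HpM (S t) ltac:(unfold t, N; lia)).
      assert (Hs := HT' (S t) ltac:(unfold t, N; lia)).
      specialize (Hb (p (S t) + d (S t)) 0 ltac:(lra) (Rle_refl _)).
      rewrite !Rminus_0_r, Rabs_R0, Rabs_pos_eq, phi_0, Rminus_0_r in Hb by lra.
      rewrite <- (proj2 (Hp t (Nat.le_0_l _))) in Hb. specialize (Hb ltac:(lra) ltac:(lra)).
      assert (HdS : d (S t) = rho * d t) by apply geom_S.
      set (x := p (S t) / d (S t)).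
      assert (Hx : p (S t) = x * (rho * d t)) by (rewrite <- HdS; unfold x; field; lra).
      set (y := p t / d t). assert (Hy : p t = y * d t) by (unfold y; field; lra).
      assert (HxM : x <= M).
      { apply Rmult_le_reg_r with (d (S t)); [lra|]. rewrite HdS at 1. rewrite <- Hx. exact HpS. }
      assert (Hx0 : 0 < x) by (apply Rdiv_lt_0_compat; lra).
      rewrite Hx, HdS, Hy in Hb.
      replace (y * d t - c * (x * (rho * d t) + rho * d t)) with ((y - k * (x + 1)) * d t) in Hb by (unfold k; ring).
      rewrite Rabs_mult, (Rabs_pos_eq (d t)) in Hb by lra.
      replace (eta * (x * (rho * d t) + rho * d t)) with (eta * rho * (x + 1) * d t) in Hb by ring.
      apply Rmult_le_reg_r in Hb; [|exact A4].
      assert (eta * rho * (x + 1) <= eta * rho * (M + 1)).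
      { apply Rmult_le_compat_l; [apply Rmult_le_pos; lra|lra]. }
      replace (y - v) with (y - k * (x + 1) + k * (x - v)) by (rewrite Hv at 2; ring).
      generalize (Rabs_triang (y - k * (x + 1)) (k * (x - v))). rewrite (Rabs_mult k), (Rabs_pos_eq k) by lra.
      lra.
    - intros n. set (t := (N + n)%nat).
      assert (A1 := proj1 (Hp t (Nat.le_0_l _))). assert (A4 := d_pos t).
      assert (A3 := HpM t ltac:(unfold t, N; lia)).
      assert (p t / d t <= M).
      { apply Rmult_le_reg_r with (d t); [lra|]. unfold Rdiv. rewrite Rmult_assoc, Rinv_l; lra. }
      assert (0 < p t / d t) by (now apply Rdiv_lt_0_compat).
      assert (Rabs (p t / d t - v) <= M + v) by (apply Rabs_le_between; lra). lra. }
  exists N. intros t Ht. specialize (He (t - N)%nat). replace (N + (t - N))%nat with t in He by lia.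
  fold k. fold v. lra.
Qed.

(** Once p_t / d_t reaches the threshold [M], it grows at least by the factor 1 / q at every date,
    and stays above [M]. An orbit that never reaches it is bounded by [M * d]. *)
Lemma orbit_decay_dichotomy p :
  orbit_from phi d 0 p -> is_lim_seq p 0 ->
  (exists M T, forall t, (T <= t)%nat -> p t <= M * d t) \/
  (exists C q T, 0 < C /\ 0 < q < 1 /\ forall t, (T <= t)%nat -> d t <= C * q ^ t * p t).
Proof.
  intros Hp Hp0. destruct exists_slope as [K [HcK HK]].
  destruct (strict_derivative_lipschitz 0 c K phi_deriv_0) as [delta [Hd HL]]; [rewrite Rabs_pos_eq; lra|].
  destruct (small_from p delta Hp0 Hd) as [T HT].
  set (k := K * rho) in *. set (q := (1 + k) / 2).
  assert (Hk : 0 < k) by (apply Rmult_lt_0_compat; lra).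
  assert (Hq : k < q < 1) by (unfold q; lra).
  (* The Lipschitz bound gives rho p_t <= k p_{t+1} + k rho d_t. [M] is the ratio from which on the
     dividend term can be absorbed, leaving rho p_t <= q p_{t+1}. *)
  set (M := k * q / (q - k)).
  assert (HM : 0 < M) by (apply Rdiv_lt_0_compat; [apply Rmult_lt_0_compat|]; lra).
  assert (HMe : M * (q - k) = k * q) by (unfold M; field; lra).
  destruct (excluded_middle_informative (exists N, (T <= N)%nat /\ M * d N <= p N)) as [[N [HN HpN]]|Hno].
  - right.
    assert (Hgrow : forall n, rho ^ n * p N <= q ^ n * p (N + n)%nat /\ M * d (N + n)%nat <= p (N + n)%nat).
    { induction n as [|n [I1 I2]].
      - rewrite Nat.add_0_r. simpl. lra.
      - rewrite Nat.add_succ_r. set (t := (N + n)%nat) in *.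
        assert (A1 := proj1 (Hp (S t) (Nat.le_0_l _))). assert (A2 := proj1 (Hp t (Nat.le_0_l _))).
        assert (A3 := d_pos (S t)). assert (A4 := d_pos t).
        assert (Hs := HT (S t) ltac:(unfold t; lia)).
        assert (Hb := HL (p (S t) + d (S t)) 0 ltac:(lra) (Rle_refl _)).
        rewrite !Rminus_0_r, Rabs_R0, Rabs_pos_eq, phi_0, Rminus_0_r in Hb by lra.
        rewrite <- (proj2 (Hp t (Nat.le_0_l _))), Rabs_pos_eq in Hb by lra. specialize (Hb ltac:(lra) ltac:(lra)).
        assert (HdS : d (S t) = rho * d t) by apply geom_S. rewrite HdS in Hb.
        assert (Hb2 : rho * p t <= k * p (S t) + k * rho * d t).
        { unfold k. apply (Rmult_le_compat_l rho) in Hb; [|lra]. lra. }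
        assert (Hd2 : k * q * d t <= (q - k) * p t).
        { rewrite <- HMe. replace (M * (q - k) * d t) with ((q - k) * (M * d t)) by ring.
          apply Rmult_le_compat_l; lra. }
        assert (Hstep : rho * p t <= q * p (S t)).
        { apply Rmult_le_reg_l with k; [exact Hk|].
          apply (Rmult_le_compat_l q) in Hb2; [|lra]. apply (Rmult_le_compat_l rho) in Hd2; [|lra]. lra. }
        split.
        + simpl. apply Rle_trans with (q ^ n * (rho * p t)).
          * apply (Rmult_le_compat_l rho) in I1; [|lra]. lra.
          * rewrite (Rmult_comm q), Rmult_assoc. apply Rmult_le_compat_l; [apply pow_le; lra|exact Hstep].
        + rewrite HdS. apply (Rmult_le_compat_l rho) in I2; [|lra]. nra. }
    assert (HpN0 := proj1 (Hp N (Nat.le_0_l _))). assert (HqN : 0 < q ^ N) by (apply pow_lt; lra).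
    exists (d N / (q ^ N * p N)), q, N. split; [|split; [lra|]].
    + apply Rdiv_lt_0_compat; [apply d_pos|]. now apply Rmult_lt_0_compat.
    + intros t Ht. destruct (Hgrow (t - N)%nat) as [H1 _].
      replace (N + (t - N))%nat with t in H1 by lia.
      assert (E1 : q ^ t = q ^ N * q ^ (t - N)) by (rewrite <- pow_add; f_equal; lia).
      assert (E2 : d t = d N * rho ^ (t - N)).
      { unfold d, geom. rewrite Rmult_assoc, <- pow_add. do 2 f_equal. lia. }
      rewrite E1, E2.
      replace (d N / (q ^ N * p N) * (q ^ N * q ^ (t - N)) * p t) with (d N / p N * (q ^ (t - N) * p t)) by (field; lra).
      replace (d N * rho ^ (t - N)) with (d N / p N * (rho ^ (t - N) * p N)) by (field; lra).
      apply Rmult_le_compat_l; [|exact H1]. apply Rlt_le, Rdiv_lt_0_compat; [apply d_pos|exact HpN0].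
  - left. exists M, T. intros t Ht. apply Rnot_lt_le. intros H. apply Hno. exists t. split; [exact Ht|lra].
Qed.

(** With slope above 1, a local right inverse of [phi] shrinks prices by 1 / g, so orbits can be
    continued forwards from a prescribed value. The danger is that subtracting dividends exhausts
    the price; starting above a fixed multiple of the dividend prevents it. *)
Lemma orbits_from_interval :
  1 < c -> exists l h T, l < h /\
    forall x, l < x < h -> exists p, orbit_from phi d T p /\ p T = x /\ is_lim_seq p 0.
Proof.
  intros Hc1. destruct exists_slope as [K [HcK HK]].
  set (g := (1 + c) / 2). assert (Hg : 1 < g < c) by (unfold g; lra).
  destruct (strict_derivative_lipschitz 0 c K phi_deriv_0) as [d1 [Hd1 HL]]; [rewrite Rabs_pos_eq; lra|].
  destruct (phi_deriv_0 (c - g)) as [d2 [Hd2 Hb]]; [lra|].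
  set (delta := Rmin d1 d2 / 2).
  assert (Hdelta : 0 < delta /\ delta < d1 /\ delta < d2).
  { unfold delta. generalize (Rmin_l d1 d2) (Rmin_r d1 d2) (Rmin_glb_lt d1 d2 0 Hd1 Hd2). lra. }
  assert (Hpre : forall p, 0 < p <= delta -> exists s, p <= K * s /\ g * s <= p /\ phi s = p).
  { intros p Hp.
    assert (Hbnd : forall s, 0 < s <= p -> g * s <= phi s <= K * s).
    { intros s Hs. assert (B1 := HL s 0 ltac:(lra) (Rle_refl _)). assert (B2 := Hb s 0 ltac:(lra) (Rle_refl _)).
      rewrite phi_0, !Rminus_0_r, Rabs_R0, (Rabs_pos_eq s) in B1, B2 by lra.
      specialize (B1 ltac:(lra) ltac:(lra)). specialize (B2 ltac:(lra) ltac:(lra)).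
      apply Rabs_le_between in B1. apply Rabs_le_between in B2. lra. }
    assert (Hs0 : 0 < p / (2 * K) < p).
    { split; [apply Rdiv_lt_0_compat; lra|]. apply Rmult_lt_reg_r with (2 * K); [lra|].
      unfold Rdiv. rewrite Rmult_assoc, Rinv_l by lra. nra. }
    destruct (IVT_interv (fun u => phi u - p) (p / (2 * K)) p) as [u [Hu Hu']]; try lra.
    - intros u Hu. apply continuity_pt_minus; [|now apply continuity_pt_const].
      apply lipschitz_continuity_pt with K d1 0; auto; try lra. rewrite Rminus_0_r, Rabs_pos_eq; lra.
    - assert (B := Hbnd (p / (2 * K)) ltac:(lra)). replace (K * (p / (2 * K))) with (p / 2) in B by (field; lra). lra.
    - assert (B := Hbnd p ltac:(lra)). nra.
    - assert (B := Hbnd u ltac:(lra)). exists u. lra. }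
  pose (psi := fun p => epsilon (inhabits 0) (fun s => p <= K * s /\ g * s <= p /\ phi s = p)).
  assert (Hpsi : forall p, 0 < p <= delta -> p <= K * psi p /\ g * psi p <= p /\ phi (psi p) = p).
  { intros p Hp. unfold psi. apply epsilon_spec. now apply Hpre. }
  set (k := K * rho) in *. assert (Hk : 0 < k) by (apply Rmult_lt_0_compat; lra).
  (* Since M = k (M + 1), the bound Q >= M d is inherited by the next date: what is left of Q / K
     after paying rho d is still at least M rho d. *)
  set (M := k / (1 - k)).
  assert (HM : M = k * (M + 1)) by (unfold M; field; lra).
  assert (HM0 : 0 < M) by (apply Rdiv_lt_0_compat; lra).
  destruct (geom_small d0 rho (delta / M)) as [T HT]; try lra; [apply Rdiv_lt_0_compat; lra|].
  specialize (HT T (le_n _)). fold (d T) in HT.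
  apply (Rmult_lt_compat_l M) in HT; [|lra]. replace (M * (delta / M)) with delta in HT by (field; lra).
  exists (M * d T), delta, T. split; [exact HT|]. intros x Hx.
  pose (Q := fix Q (n : nat) : R := match n with O => x | S n => psi (Q n) - d (T + S n)%nat end).
  assert (Hx0 : 0 < x). { assert (0 < M * d T) by (apply Rmult_lt_0_compat; [lra|apply d_pos]). lra. }
  assert (HQ : forall n, M * d (T + n)%nat <= Q n /\ Q n <= x * (/ g) ^ n).
  { assert (Hig : / g < 1) by (rewrite <- Rinv_1; apply Rinv_lt_contravar; lra).
    assert (0 < / g) by (apply Rinv_0_lt_compat; lra).
    induction n as [|n [I1 I2]].
    - rewrite Nat.add_0_r. simpl. lra.
    - change (Q (S n)) with (psi (Q n) - d (T + S n)%nat). rewrite Nat.add_succ_r.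
      assert (HdS : d (S (T + n)) = rho * d (T + n)%nat) by apply geom_S. rewrite HdS.
      assert (A := d_pos (T + n)%nat).
      assert (0 < M * d (T + n)%nat) by (now apply Rmult_lt_0_compat).
      assert ((/ g) ^ n <= 1). { rewrite <- (pow1 n). apply pow_incr. lra. }
      destruct (Hpsi (Q n)) as [P1 [P2 _]]; [nra|].
      split.
      + apply Rmult_le_reg_l with K; [lra|].
        replace (K * (M * (rho * d (T + n)%nat))) with (k * M * d (T + n)%nat) by (unfold k; ring).
        replace (K * (psi (Q n) - rho * d (T + n)%nat)) with (K * psi (Q n) - k * d (T + n)%nat) by (unfold k; ring).
        assert (k * M * d (T + n)%nat + k * d (T + n)%nat = M * d (T + n)%nat) by (rewrite HM at 2; ring). lra.
      + apply Rmult_le_reg_l with g; [lra|]. simpl.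
        replace (g * (x * (/ g * (/ g) ^ n))) with (x * (/ g) ^ n) by (field; lra).
        assert (0 < rho * d (T + n)%nat) by (apply Rmult_lt_0_compat; lra). nra. }
  assert (Hig : 0 < / g < 1).
  { split; [apply Rinv_0_lt_compat; lra|]. rewrite <- Rinv_1; apply Rinv_lt_contravar; lra. }
  assert (HQ0 : forall n, 0 < Q n <= delta).
  { intros n. destruct (HQ n) as [I1 I2]. assert (A := d_pos (T + n)%nat).
    assert (0 < M * d (T + n)%nat) by (now apply Rmult_lt_0_compat).
    assert ((/ g) ^ n <= 1). { rewrite <- (pow1 n). apply pow_incr. lra. }
    nra. }
  exists (fun t => Q (t - T)%nat). split; [|split].
  - intros t Ht. split; [apply HQ0|].
    replace (S t - T)%nat with (S (t - T))%nat by lia.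
    change (Q (S (t - T))%nat) with (psi (Q (t - T)%nat) - d (T + S (t - T))%nat).
    replace (T + S (t - T))%nat with (S t) by lia.
    replace (psi (Q (t - T)%nat) - d (S t) + d (S t)) with (psi (Q (t - T)%nat)) by ring.
    symmetry. apply Hpsi, HQ0.
  - rewrite Nat.sub_diag. reflexivity.
  - apply is_lim_seq_of_geom_bound with (x / (/ g) ^ T) (/ g) T; auto.
    { apply Rdiv_lt_0_compat; [lra|]. apply pow_lt; lra. }
    intros t Ht. rewrite Rminus_0_r, Rabs_pos_eq; [|apply Rlt_le, HQ0].
    apply Rle_trans with (1 := proj2 (HQ (t - T)%nat)). right. unfold geom.
    replace ((/ g) ^ t) with ((/ g) ^ T * (/ g) ^ (t - T)) by (rewrite <- pow_add; f_equal; lia).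
    field. repeat split; try apply pow_nonzero; lra.
Qed.

(* An orbit converging to 0 is recovered from a date T after which it stays
   where [phi] is injective together with its value at T, and both fit in the
   single real number T + p T. *)
Lemma vanishing_orbits_encode :
  (forall s, phi s < 1) ->
  exists code : (nat -> R) -> R, forall p q,
    orbit_from phi d 0 p -> is_lim_seq p 0 -> orbit_from phi d 0 q -> is_lim_seq q 0 ->
    code p = code q -> forall t, p t = q t.
Proof.
  intros Hphi1.
  destruct (phi_deriv_0 (c / 2)) as [delta [Hd Hb]]; [lra|].
  assert (Hinj : forall x y, 0 <= x < delta -> 0 <= y < delta -> phi x = phi y -> x = y).
  { intros x y Hx Hy Hxy.
    assert (B := Hb x y ltac:(lra) ltac:(lra)). rewrite !Rminus_0_r, (Rabs_pos_eq x), (Rabs_pos_eq y), Hxy in B by lra.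
    specialize (B ltac:(lra) ltac:(lra)).
    replace (phi y - phi y - c * (x - y)) with (- (c * (x - y))) in B by ring.
    rewrite Rabs_Ropp, Rabs_mult, (Rabs_pos_eq c) in B by lra.
    destruct (Req_dec x y) as [|Hne]; [assumption|].
    assert (0 < Rabs (x - y)) by (apply Rabs_pos_lt; lra). nra. }
  pose (date := fun p => epsilon (inhabits O) (fun T => forall t, (T <= t)%nat -> p t + d t < delta)).
  assert (Hdate : forall p, is_lim_seq p 0 -> forall t, (date p <= t)%nat -> p t + d t < delta).
  { intros p Hp. unfold date. apply epsilon_spec. now apply small_from. }
  exists (fun p => INR (date p) + p (date p)).
  intros p q Hp Hp0 Hq Hq0 Hcode.
  assert (Hu : forall r, orbit_from phi d 0 r -> forall t, 0 < r t < 1).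
  { intros r Hr t. destruct (Hr t (Nat.le_0_l _)) as [H1 H2]. split; [exact H1|]. rewrite H2. apply Hphi1. }
  assert (HT : date p = date q).
  { generalize (Hu p Hp (date p)) (Hu q Hq (date q)). intros B1 B2.
    destruct (Nat.lt_trichotomy (date p) (date q)) as [H|[H|H]]; [|exact H|];
      apply le_INR in H; rewrite S_INR in H; lra. }
  assert (Htail : forall n, p (date p + n)%nat = q (date p + n)%nat).
  { induction n as [|n IH].
    - rewrite Nat.add_0_r. rewrite <- HT in Hcode. lra.
    - rewrite Nat.add_succ_r. set (t := (date p + n)%nat) in *.
      assert (A1 := proj1 (Hu p Hp (S t))). assert (A2 := proj1 (Hu q Hq (S t))). assert (A3 := d_pos (S t)).
      assert (B1 := Hdate p Hp0 (S t) ltac:(unfold t; lia)).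
      assert (B2 := Hdate q Hq0 (S t) ltac:(rewrite <- HT; unfold t; lia)).
      rewrite (proj2 (Hp t (Nat.le_0_l _))), (proj2 (Hq t (Nat.le_0_l _))) in IH.
      apply Hinj in IH; lra. }
  apply orbit_eq_of_tail with phi d (date p); auto.
  intros t Ht. specialize (Htail (t - date p)%nat). now replace (date p + (t - date p))%nat with t in Htail by lia.
Qed.
End AtZero.
End Decay.

(** * The marginal rate of substitution *)

Lemma is_derive_continuous (f : R -> R) (x l : R) : is_derive f x l -> continuous f x.
Proof. intros H. apply @ex_derive_continuous. now exists l. Qed.

Lemma is_derive_continuity_pt (f : R -> R) (x l : R) : is_derive f x l -> continuity_pt f x.
Proof. intros H. apply continuity_pt_filterlim. now apply is_derive_continuous with l. Qed.

Lemma mean_value (f f' : R -> R) (x y : R) : x < y ->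
  (forall c, x <= c <= y -> is_derive f c (f' c)) ->
  exists c, x <= c <= y /\ f y - f x = f' c * (y - x).
Proof.
  intros Hxy H. destruct (MVT_gen f x y f') as [c Hc];
    rewrite ?Rmin_left, ?Rmax_right in * by lra; [| |now exists c].
  - intros c Hc. apply H. lra.
  - intros c Hc. apply is_derive_continuity_pt with (f' c), H, Hc.
Qed.

Section Utility.
Variable U : R -> R -> R.
Hypothesis HU : standard_utility U.

Let f (x : R) : R := U 1 x.
Let f1 (x : R) : R := partial_z U 1 x.
Let f2 (x : R) : R := partial_z (partial_z U) 1 x.

Let U_ray y z : 0 < y -> 0 < z -> U y z = y * f (z / y).
Proof.
  intros Hy Hz. unfold f. rewrite <- (utility_homogeneous U HU) by (try apply Rdiv_lt_0_compat; lra).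
  f_equal; field; lra.
Qed.

Let f_deriv x : 0 < x -> is_derive f x (f1 x).
Proof.
  intros Hx. apply Derive_correct. apply (utility_C2 U HU 1 x); lra.
Qed.

Let f1_deriv x : 0 < x -> is_derive f1 x (f2 x).
Proof.
  intros Hx. apply Derive_correct. apply (utility_C2 U HU 1 x); lra.
Qed.

Let f2_cont x : 0 < x -> continuous f2 x.
Proof.
  intros Hx. destruct (utility_C2 U HU 1 x) as [_ [_ [_ [_ [_ [_ [_ [_ [H _]]]]]]]]]; try lra.
  change (continuity_2d_pt (partial_z (partial_z U)) 1 x) in H.
  intros P [eps HP]. destruct (H eps) as [delta Hd]. exists delta. intros y Hy. apply HP.
  apply (Hd 1 y); [|exact Hy]. rewrite Rminus_diag_eq, Rabs_R0 by reflexivity. apply cond_pos.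
Qed.

Lemma partial_z_ray y z : 0 < y -> 0 < z -> partial_z U y z = partial_z U 1 (z / y).
Proof.
  intros Hy Hz. apply is_derive_unique.
  apply is_derive_ext_loc with (fun s => y * f (s / y)).
  - exists (mkposreal z Hz). intros s Hs. symmetry. apply U_ray; [exact Hy|].
    apply Rabs_lt_between in Hs. simpl in Hs. unfold minus, plus, opp in Hs; simpl in Hs. lra.
  - assert (Hzy : 0 < z / y) by (now apply Rdiv_lt_0_compat).
    evar_last; [apply is_derive_scal; apply (is_derive_comp f (fun s => s / y)); [apply f_deriv, Hzy | auto_derive; [lra|reflexivity]]|].
    unfold scal; simpl; unfold mult; simpl. fold (f1 (z / y)). field. lra.
Qed.

Lemma partial_y_ray y z : 0 < y -> 0 < z ->
  partial_y U y z = U 1 (z / y) - z / y * partial_z U 1 (z / y).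
Proof.
  intros Hy Hz. apply is_derive_unique.
  apply is_derive_ext_loc with (fun s => s * f (z / s)).
  - exists (mkposreal y Hy). intros s Hs. symmetry. apply U_ray; [|exact Hz].
    apply Rabs_lt_between in Hs. simpl in Hs. unfold minus, plus, opp in Hs; simpl in Hs. lra.
  - assert (Hzy : 0 < z / y) by (now apply Rdiv_lt_0_compat).
    evar_last; [apply (is_derive_mult (fun s => s) (fun s => f (z / s)));
      [apply is_derive_id | apply (is_derive_comp f (fun s => z / s)); [apply f_deriv, Hzy | auto_derive; [lra|reflexivity]] | intros; apply Rmult_comm]|].
    unfold scal, plus, mult, one; simpl; unfold mult; simpl. fold (f (z / y)). fold (f1 (z / y)). field. lra.
Qed.

Definition ray_mrs (x : R) : R := partial_y U 1 x / partial_z U 1 x.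

Let f1_pos x : 0 < x -> 0 < f1 x.
Proof. intros Hx. apply (utility_z_pos U HU); lra. Qed.

Let Uy_1 x : 0 < x -> partial_y U 1 x = f x - x * f1 x.
Proof. intros Hx. rewrite partial_y_ray by lra. now rewrite Rdiv_1_r. Qed.

Let ray_mrs_eq x : 0 < x -> ray_mrs x = f x / f1 x - x.
Proof.
  intros Hx. unfold ray_mrs. rewrite Uy_1 by exact Hx. fold (f1 x).
  generalize (f1_pos x Hx). intros. field. lra.
Qed.

Lemma ray_mrs_pos x : 0 < x -> 0 < ray_mrs x.
Proof.
  intros Hx. apply Rdiv_lt_0_compat; [apply (utility_y_pos U HU)|apply (utility_z_pos U HU)]; lra.
Qed.

(** By homogeneity the marginal rate of substitution on the ray is f / f' - x with f = U(1, .), and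
    this is its derivative - f f'' / f'^2. *)
Definition ray_mrs' (x : R) : R := - (U 1 x * partial_z (partial_z U) 1 x) / (partial_z U 1 x) ^ 2.

Lemma ray_mrs_derive x : 0 < x -> is_derive ray_mrs x (ray_mrs' x).
Proof.
  intros Hx. apply is_derive_ext_loc with (fun x => f x / f1 x - x).
  - exists (mkposreal x Hx). intros s Hs. symmetry. apply ray_mrs_eq.
    apply Rabs_lt_between in Hs. simpl in Hs. unfold minus, plus, opp in Hs; simpl in Hs. lra.
  - generalize (f1_pos x Hx). intros Hp.
    evar_last; [apply (is_derive_minus (fun x => f x / f1 x) (fun x => x));
      [apply is_derive_div; [now apply f_deriv|now apply f1_deriv|lra]|apply is_derive_id]|].
    unfold minus, plus, opp, one; simpl. unfold ray_mrs'. fold (f x) (f1 x) (f2 x). field. lra.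
Qed.

Lemma ray_mrs'_pos x : 0 < x -> 0 < ray_mrs' x.
Proof.
  intros Hx. unfold ray_mrs'. apply Rdiv_lt_0_compat; [|apply pow_lt, f1_pos, Hx].
  generalize (utility_pos U HU 1 x ltac:(lra) Hx) (utility_zz_neg U HU 1 x ltac:(lra) Hx). nra.
Qed.

Lemma ray_mrs'_continuous x : 0 < x -> continuous ray_mrs' x.
Proof.
  intros Hx. apply (continuous_mult (fun x => - (f x * f2 x)) (fun x => / (f1 x) ^ 2)).
  - apply (continuous_opp (fun x => f x * f2 x)). apply (continuous_mult f f2); [|now apply f2_cont].
    apply is_derive_continuous with (f1 x). now apply f_deriv.
  - apply (continuous_comp (fun x => f1 x ^ 2) Rinv).
    + eapply is_derive_continuous, (is_derive_pow f1 2), f1_deriv, Hx.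
    + apply continuous_Rinv. apply pow_nonzero. generalize (f1_pos x Hx). lra.
Qed.

Lemma ray_mrs_increasing x y : 0 < x -> x < y -> ray_mrs x < ray_mrs y.
Proof.
  intros Hx Hxy. destruct (mean_value ray_mrs ray_mrs' x y Hxy) as [c [Hc He]].
  - intros c Hc. apply ray_mrs_derive. lra.
  - generalize (ray_mrs'_pos c ltac:(lra)). nra.
Qed.

Let f_incr x y : 0 < x -> x < y -> f x < f y /\ f1 y < f1 x.
Proof.
  intros Hx Hxy. split.
  - destruct (mean_value f f1 x y) as [c [Hc He]]; [lra| |].
    + intros c Hc. apply f_deriv. lra.
    + generalize (f1_pos c ltac:(lra)). nra.
  - destruct (mean_value f1 f2 x y) as [c [Hc He]]; [lra| |].
    + intros c Hc. apply f1_deriv. lra.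
    + generalize (utility_zz_neg U HU 1 c ltac:(lra) ltac:(lra)). fold (f2 c). nra.
Qed.

Let at_right_0_gt (h : R -> R) (M : R) : filterlim h (at_right 0) (Rbar_locally p_infty) ->
  exists x, 0 < x < 1 /\ M < h x.
Proof.
  intros H. destruct (H (fun y => M < y)) as [delta Hd]; [exists M; tauto|].
  exists (Rmin delta 1 / 2).
  generalize (Rmin_l delta 1) (Rmin_r delta 1) (Rmin_glb_lt delta 1 0 (cond_pos delta) Rlt_0_1). intros.
  split; [lra|]. apply Hd; [|lra]. unfold ball; simpl; unfold AbsRing_ball; simpl.
  unfold minus, plus, opp, abs; simpl. rewrite Rabs_pos_eq; lra.
Qed.

(** Near 0 the marginal utility f' is unbounded while f stays below f(1), so f / f' is small. *)
Let ray_mrs_small eps : 0 < eps -> exists x, 0 < x /\ ray_mrs x < eps.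
Proof.
  intros He. destruct (at_right_0_gt (fun z => partial_z U 1 z) (f 1 / eps)) as [x [Hx Hfx]].
  { apply (utility_z_at_0 U HU). lra. }
  exists x. split; [lra|]. rewrite ray_mrs_eq by lra. fold (f1 x) in Hfx.
  assert (Hf := proj1 (f_incr x 1 ltac:(lra) ltac:(lra))).
  assert (H1 := f1_pos x ltac:(lra)).
  apply (Rmult_lt_compat_r eps) in Hfx; [|exact He]. unfold Rdiv in Hfx. rewrite Rmult_assoc, Rinv_l in Hfx by lra.
  apply Rmult_lt_reg_r with (f1 x); [exact H1|].
  replace ((f x / f1 x - x) * f1 x) with (f x - x * f1 x) by (field; lra). nra.
Qed.

(** U_y(y, 1) depends only on the ray x = 1 / y, so its blow-up at y = 0 concerns large x, where the
    denominator f'(x) stays below f'(1). *)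
Let ray_mrs_large M : exists x, 0 < x /\ M < ray_mrs x.
Proof.
  assert (H1 := f1_pos 1 ltac:(lra)).
  destruct (at_right_0_gt (fun y => partial_y U y 1) (Rmax M 0 * f1 1)) as [y [Hy Hfy]].
  { apply (utility_y_at_0 U HU). lra. }
  rewrite partial_y_ray in Hfy by lra.
  assert (H1y : 1 < 1 / y). { unfold Rdiv. rewrite Rmult_1_l, <- Rinv_1. apply Rinv_lt_contravar; lra. }
  fold (f (1 / y)) (f1 (1 / y)) in Hfy. set (x := 1 / y) in *.
  exists x. split; [lra|]. rewrite ray_mrs_eq by lra.
  assert (Hf := proj2 (f_incr 1 x ltac:(lra) ltac:(lra))). assert (H2 := f1_pos x ltac:(lra)).
  apply Rmult_lt_reg_r with (f1 x); [exact H2|].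
  replace ((f x / f1 x - x) * f1 x) with (f x - x * f1 x) by (field; lra).
  generalize (Rmax_l M 0) (Rmax_r M 0). nra.
Qed.

Lemma ray_mrs_surjective y : 0 < y -> exists x, 0 < x /\ ray_mrs x = y.
Proof.
  intros Hy. destruct (ray_mrs_small y Hy) as [x1 [Hx1 H1]]. destruct (ray_mrs_large y) as [x2 [Hx2 H2]].
  assert (Hx : x1 < x2).
  { destruct (Rtotal_order x1 x2) as [|[->|H]]; [assumption|lra|].
    generalize (ray_mrs_increasing x2 x1 Hx2 H). lra. }
  destruct (IVT_interv (fun x => ray_mrs x - y) x1 x2) as [x [Hx' He]]; try lra.
  - intros c Hc. apply continuity_pt_minus; [|now apply continuity_pt_const].
    apply is_derive_continuity_pt with (ray_mrs' c), ray_mrs_derive. lra.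
  - exists x. split; lra.
Qed.

(* Homogeneity reduces this to the concavity of U(1, .). *)
Lemma utility_le_tangent y z y' z' : 0 < y -> 0 < z -> 0 < y' -> 0 < z' ->
  U y' z' <= partial_y U y z * y' + partial_z U y z * z'.
Proof.
  intros Hy Hz Hy' Hz'. rewrite (partial_y_ray y z), (partial_z_ray y z), (U_ray y' z') by assumption.
  assert (Hx : 0 < z / y) by (now apply Rdiv_lt_0_compat).
  assert (Hx' : 0 < z' / y') by (now apply Rdiv_lt_0_compat).
  fold (f (z / y)) (f1 (z / y)). set (x := z / y) in *. set (x' := z' / y') in *.
  assert (Hz'e : z' = y' * x') by (unfold x'; field; lra). rewrite Hz'e.
  enough (f x' <= f x + f1 x * (x' - x)) by nra.
  destruct (Rtotal_order x x') as [H|[<-|H]]; [| lra |].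
  - destruct (mean_value f f1 x x') as [c [Hc He]]; [lra| |].
    + intros c Hc. apply f_deriv. lra.
    + destruct (Req_dec c x) as [->|]; [lra|].
      generalize (proj2 (f_incr x c Hx ltac:(lra))). nra.
  - destruct (mean_value f f1 x' x) as [c [Hc He]]; [lra| |].
    + intros c Hc. apply f_deriv. lra.
    + destruct (Req_dec c x) as [->|]; [lra|].
      generalize (proj2 (f_incr c x ltac:(lra) ltac:(lra))). nra.
Qed.

Lemma utility_eq_tangent y z : 0 < y -> 0 < z ->
  U y z = partial_y U y z * y + partial_z U y z * z.
Proof.
  intros Hy Hz. rewrite (partial_y_ray y z), (partial_z_ray y z), (U_ray y z) by assumption.
  fold (f (z / y)) (f1 (z / y)). field. lra.
Qed.

(** The budget line is parametrised by the holding x, with the candidate at x = 1. Necessity is the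
    first-order condition at this interior maximum. For sufficiency, the supporting linear function
    at (y, z) is constant along the budget line, dominates U, and equals U at (y, z). *)
Lemma optimal_iff_euler y z P Q : 0 < y -> 0 < z -> 0 < P -> 0 < Q ->
  (forall x, 0 < y + P - P * x -> 0 < z - Q + Q * x ->
     U (y + P - P * x) (z - Q + Q * x) <= U y z)
  <-> ray_mrs (z / y) * P = Q.
Proof.
  intros Hy Hz HP HQ. assert (Hzy : 0 < z / y) by (now apply Rdiv_lt_0_compat).
  assert (Hp := f1_pos (z / y) Hzy). split.
  - intros Hmax.
    pose (Y := fun x => y + P - P * x). pose (Z := fun x => z - Q + Q * x).
    pose (g := fun x => Y x * f (Z x / Y x)).
    assert (Hg : is_derive g 1 (- P * f (z / y) + f1 (z / y) * (Q + P * (z / y)))).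
    { assert (HZ1 : Z 1 = z) by (unfold Z; ring). assert (HY1 : Y 1 = y) by (unfold Y; ring).
      evar_last; [apply (is_derive_mult Y (fun x => f (Z x / Y x)));
        [unfold Y; auto_derive; [exact I|reflexivity]
        |apply (is_derive_comp f (fun x => Z x / Y x)); [rewrite HZ1, HY1; apply f_deriv, Hzy|
           apply is_derive_div; [unfold Z; auto_derive; [exact I|reflexivity]|unfold Y; auto_derive; [exact I|reflexivity]|lra]]
        |intros; apply Rmult_comm]|].
      rewrite HZ1, HY1. unfold scal, plus, mult, one; simpl; unfold mult; simpl. field. lra. }
    (* Within distance [r] of x = 1 both consumptions stay positive. *)
    pose (r := Rmin (y / P) (z / Q)).
    assert (Hr : 0 < r /\ r <= y / P /\ r <= z / Q).
    { unfold r. split; [|split; [apply Rmin_l|apply Rmin_r]]. apply Rmin_glb_lt; now apply Rdiv_lt_0_compat. }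
    assert (HrP : r * P <= y).
    { apply Rle_trans with (y / P * P); [apply Rmult_le_compat_r; lra|right; field; lra]. }
    assert (HrQ : r * Q <= z).
    { apply Rle_trans with (z / Q * Q); [apply Rmult_le_compat_r; lra|right; field; lra]. }
    apply is_derive_Reals in Hg.
    assert (H0 := deriv_maximum g (1 - r) (1 + r) 1 (exist _ _ Hg) ltac:(lra) ltac:(lra)).
    cbn in H0. unfold derive_pt in H0. cbn in H0.
    rewrite ray_mrs_eq by exact Hzy.
    assert (H00 : - P * f (z / y) + f1 (z / y) * (Q + P * (z / y)) = 0).
    { apply H0. intros x Hx1 Hx2. unfold g.
      assert (HYx : 0 < Y x) by (unfold Y; nra). assert (HZx : 0 < Z x) by (unfold Z; nra).
      rewrite <- U_ray by assumption. replace (Y 1) with y by (unfold Y; ring). replace (Z 1) with z by (unfold Z; ring).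
      rewrite <- U_ray by assumption. now apply Hmax. }
    apply Rmult_eq_reg_l with (f1 (z / y)); [|lra].
    replace (f1 (z / y) * ((f (z / y) / f1 (z / y) - z / y) * P)) with (P * f (z / y) - P * (z / y) * f1 (z / y)) by (field; lra).
    lra.
  - intros HE x Hx1 Hx2.
    apply Rle_trans with (1 := utility_le_tangent y z _ _ Hy Hz Hx1 Hx2).
    rewrite (utility_eq_tangent y z) at 1 by assumption.
    assert (HE' : partial_y U y z * P = partial_z U y z * Q).
    { rewrite (partial_y_ray y z), (partial_z_ray y z) by assumption. fold (f (z / y)) (f1 (z / y)).
      rewrite <- HE, ray_mrs_eq by exact Hzy. field. lra. }
    right.
    replace (partial_y U y z * (y + P - P * x)) with (partial_y U y z * y + partial_y U y z * P * (1 - x)) by ring.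
    rewrite HE'. ring.
Qed.
End Utility.

(** * The price recursion *)

Lemma increment_of_continuous_derivative (g g' : R -> R) (x0 eps : R) :
  0 < x0 -> (forall x, 0 < x -> is_derive g x (g' x)) -> continuous g' x0 -> 0 < eps ->
  exists delta, 0 < delta /\ forall x y, Rabs (x - x0) < delta -> Rabs (y - x0) < delta ->
    Rabs (g x - g y - g' x0 * (x - y)) <= eps * Rabs (x - y).
Proof.
  intros Hx0 Hg Hg' He. apply continuity_pt_filterlim in Hg'. rewrite continuity_pt_locally in Hg'.
  destruct (Hg' (mkposreal _ He)) as [d1 Hd1]. simpl in Hd1.
  exists (Rmin d1 x0). split; [apply Rmin_glb_lt; [apply cond_pos|exact Hx0]|].
  assert (Hlt : forall x y, x < y -> Rabs (x - x0) < Rmin d1 x0 -> Rabs (y - x0) < Rmin d1 x0 ->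
    Rabs (g y - g x - g' x0 * (y - x)) <= eps * Rabs (y - x)).
  { intros x y Hxy Hx Hy. apply Rabs_lt_between in Hx. apply Rabs_lt_between in Hy.
    generalize (Rmin_l d1 x0) (Rmin_r d1 x0). intros B1 B2.
    destruct (mean_value g g' x y Hxy) as [c [Hc ->]].
    - intros c Hc. apply Hg. lra.
    - replace (g' c * (y - x) - g' x0 * (y - x)) with ((g' c - g' x0) * (y - x)) by ring.
      rewrite Rabs_mult. apply Rmult_le_compat_r; [apply Rabs_pos|]. apply Rlt_le, Hd1.
      change (Rabs (c - x0) < d1). apply Rabs_lt_between. lra. }
  intros x y Hx Hy. destruct (Rtotal_order x y) as [H|[->|H]].
  - rewrite <- Rabs_Ropp, (Rabs_minus_sym x y).
    replace (- (g x - g y - g' x0 * (x - y))) with (g y - g x - g' x0 * (y - x)) by ring. now apply Hlt.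
  - replace (g y - g y - g' x0 * (y - y)) with 0 by ring. replace (y - y) with 0 by ring. rewrite Rabs_R0. lra.
  - now apply Hlt.
Qed.

Section Backward.
Variable e : economy.
Local Notation m := (ray_mrs (util e)).
Local Notation m' := (ray_mrs' (util e)).
Local Notation g := (G e).
Local Notation w := (income_ratio e).

Let m_pos := ray_mrs_pos (util e) (util_standard e).
Let m_derive := ray_mrs_derive (util e) (util_standard e).
Let m'_pos := ray_mrs'_pos (util e) (util_standard e).
Let m'_continuous := ray_mrs'_continuous (util e) (util_standard e).
Let m_increasing := ray_mrs_increasing (util e) (util_standard e).
Let m_surjective := ray_mrs_surjective (util e) (util_standard e).
Let g_pos : 0 < g.
Proof. apply G_pos. Qed.

Lemma income_ratio_nonneg : 0 <= w.
Proof.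
  unfold income_ratio. apply Rmult_le_pos; [apply b_nonneg|].
  apply Rlt_le, Rinv_0_lt_compat, a_pos.
Qed.

Let w_nonneg : 0 <= w.
Proof. apply income_ratio_nonneg. Qed.

(* The Euler equation m(X) p = g s, with X = g(w + s)/(1 - p) the consumption
   ratio of a generation, is solved by (p, s) = (saving X, payoff X). *)
Definition saving (X : R) : R := (X - g * w) / (X + m X).
Definition payoff (X : R) : R := m X * (X - g * w) / (g * (X + m X)).

Definition saving' (X : R) : R :=
  (X + m X - (X - g * w) * (1 + m' X)) / (X + m X) ^ 2.
Definition payoff' (X : R) : R :=
  (m' X * X * (X - g * w) + m X * (m X + g * w)) / (g * (X + m X) ^ 2).

Let Gw_nonneg : 0 <= g * w.
Proof. apply Rmult_le_pos; lra. Qed.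

Lemma saving_derive X : 0 < X -> is_derive saving X (saving' X).
Proof.
  intros HX. assert (Hm := m_pos X HX). assert (Hd := m_derive X HX).
  unfold saving. evar_last;
    [apply (is_derive_div (fun X => X - g * w) (fun X => X + m X));
      [auto_derive; [exact I|reflexivity] | apply @is_derive_plus; [apply @is_derive_id|exact Hd] | lra]|].
  unfold saving', plus, one; simpl. field. lra.
Qed.

Lemma payoff_derive X : 0 < X -> is_derive payoff X (payoff' X).
Proof.
  intros HX. assert (Hm := m_pos X HX). assert (Hd := m_derive X HX).
  unfold payoff. evar_last;
    [apply (is_derive_div (fun X => m X * (X - g * w)) (fun X => g * (X + m X)));
      [apply (is_derive_mult m (fun X => X - g * w)); [exact Hd|auto_derive; [exact I|reflexivity]|intros; apply Rmult_comm]
      |apply is_derive_scal; apply @is_derive_plus; [apply @is_derive_id|exact Hd]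
      |apply Rmult_integral_contrapositive; split; lra]|].
  unfold payoff', plus, one, mult; simpl; unfold mult; simpl. field. lra.
Qed.

(** Monotonicity of [payoff] is what allows X to be recovered from the payoff; [saving'] has no
    definite sign, so X cannot be recovered from the price in the same way. *)
Lemma payoff'_pos X : 0 < X -> g * w <= X -> 0 < payoff' X.
Proof.
  intros HX HwX. assert (Hm := m_pos X HX). assert (Hm' := m'_pos X HX). unfold payoff'.
  apply Rdiv_lt_0_compat; [|apply Rmult_lt_0_compat; [lra|apply pow_lt; lra]].
  assert (0 <= m' X * X * (X - g * w)) by (apply Rmult_le_pos; [apply Rmult_le_pos|]; lra).
  assert (0 < m X * (m X + g * w)) by (apply Rmult_lt_0_compat; lra). lra.
Qed.

Let m_continuous X : 0 < X -> continuous m X.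
Proof. intros HX. apply is_derive_continuous with (m' X); auto. Qed.

Let saving'_continuous X : 0 < X -> continuous saving' X.
Proof.
  intros HX. assert (Hm := m_pos X HX).
  apply continuity_pt_filterlim. unfold saving'.
  assert (Cm : continuity_pt m X) by (apply continuity_pt_filterlim; now apply m_continuous).
  assert (Cm' : continuity_pt m' X) by (apply continuity_pt_filterlim; now apply m'_continuous).
  assert (Cid : continuity_pt (fun X => X) X) by apply continuity_pt_id.
  assert (Cc : forall k : R, continuity_pt (fun _ => k) X) by (intros k; now apply continuity_pt_const).
  apply (continuity_pt_div (fun X => X + m X - (X - g * w) * (1 + m' X)) (fun X => (X + m X) ^ 2)).
  - apply continuity_pt_minus; [now apply continuity_pt_plus|].
    apply (continuity_pt_mult (fun X => X - g * w) (fun X => 1 + m' X)).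
    + now apply (continuity_pt_minus (fun X => X)).
    + now apply (continuity_pt_plus (fun _ => 1)).
  - apply (continuity_pt_comp (fun X => X + m X) (fun u => u ^ 2)); [now apply (continuity_pt_plus (fun X => X))|].
    apply derivable_continuous_pt, derivable_pt_pow.
  - apply pow_nonzero. lra.
Qed.

Let payoff'_continuous X : 0 < X -> continuous payoff' X.
Proof.
  intros HX. assert (Hm := m_pos X HX).
  apply continuity_pt_filterlim. unfold payoff'.
  assert (Cm : continuity_pt m X) by (apply continuity_pt_filterlim; now apply m_continuous).
  assert (Cm' : continuity_pt m' X) by (apply continuity_pt_filterlim; now apply m'_continuous).
  assert (Cid : continuity_pt (fun X => X) X) by apply continuity_pt_id.
  assert (Cc : forall k : R, continuity_pt (fun _ => k) X) by (intros k; now apply continuity_pt_const).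
  apply (continuity_pt_div (fun X => m' X * X * (X - g * w) + m X * (m X + g * w)) (fun X => g * (X + m X) ^ 2)).
  - apply (continuity_pt_plus (fun X => m' X * X * (X - g * w))).
    + apply (continuity_pt_mult (fun X => m' X * X)); [now apply (continuity_pt_mult m')|].
      now apply (continuity_pt_minus (fun X => X)).
    + apply (continuity_pt_mult m); [exact Cm|]. now apply (continuity_pt_plus m).
  - apply (continuity_pt_mult (fun _ => g)); [apply Cc|].
    apply (continuity_pt_comp (fun X => X + m X) (fun u => u ^ 2)); [now apply (continuity_pt_plus (fun X => X))|].
    apply derivable_continuous_pt, derivable_pt_pow.
  - apply Rmult_integral_contrapositive. split; [lra|]. apply pow_nonzero. lra.
Qed.

Lemma payoff_increasing X Y : 0 < X -> g * w <= X -> X < Y -> payoff X < payoff Y.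
Proof.
  intros HX HwX HXY. destruct (mean_value payoff payoff' X Y HXY) as [c [Hc He]].
  - intros c Hc. apply payoff_derive. lra.
  - assert (0 < payoff' c) by (apply payoff'_pos; lra). nra.
Qed.

Lemma payoff_Gw : payoff (g * w) = 0.
Proof. unfold payoff. rewrite Rminus_diag_eq by reflexivity. unfold Rdiv. ring. Qed.

Lemma saving_Gw : saving (g * w) = 0.
Proof. unfold saving. rewrite Rminus_diag_eq by reflexivity. unfold Rdiv. ring. Qed.

Lemma payoff_pos X : g * w < X -> 0 < payoff X.
Proof.
  intros HX. assert (Hm := m_pos X ltac:(lra)). unfold payoff.
  apply Rdiv_lt_0_compat; apply Rmult_lt_0_compat; lra.
Qed.

Lemma saving_bounds X : g * w < X -> 0 < saving X < 1.
Proof.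
  intros HX. assert (Hm := m_pos X ltac:(lra)). unfold saving. split.
  - apply Rdiv_lt_0_compat; lra.
  - apply Rmult_lt_reg_r with (X + m X); [lra|].
    unfold Rdiv. rewrite Rmult_assoc, Rinv_l; lra.
Qed.

Lemma payoff_saving X : g * w < X -> g * payoff X = m X * saving X.
Proof. intros HX. assert (Hm := m_pos X ltac:(lra)). unfold payoff, saving. field. lra. Qed.

Lemma payoff_surjective s : 0 < s -> exists X, g * w < X /\ payoff X = s.
Proof.
  intros Hs. assert (HGs : 0 < g * s) by (now apply Rmult_lt_0_compat).
  (* The factor m / (X + m) is below 1, so [payoff X1] is less than (X1 - g w) / g = s / 2. *)
  set (X1 := g * w + g * s / 2).
  assert (H1 : payoff X1 < s).
  { assert (HX1 : 0 < X1) by (unfold X1; lra). assert (Hm := m_pos X1 HX1).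
    unfold payoff. apply Rmult_lt_reg_r with (g * (X1 + m X1)); [apply Rmult_lt_0_compat; lra|].
    unfold Rdiv. rewrite Rmult_assoc, Rinv_l by (apply Rmult_integral_contrapositive; split; lra).
    replace (X1 - g * w) with (g * s / 2) by (unfold X1; ring).
    assert (0 < g * s * X1) by (now apply Rmult_lt_0_compat).
    assert (0 < g * s * m X1) by (now apply Rmult_lt_0_compat). nra. }
  (* Beyond 2 g w the payoff exceeds m X / (2 g (X + m)), hence min(m, X) / (4 g). It remains to
     make both m and X exceed 4 g s. *)
  destruct (m_surjective (4 * (g * s))) as [X0 [HX0 Hm0]]; [lra|].
  set (X2 := Rmax X0 (Rmax (2 * (g * w)) (4 * (g * s))) + 1).
  assert (HX2 : X0 < X2 /\ 2 * (g * w) < X2 /\ 4 * (g * s) < X2).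
  { unfold X2. generalize (Rmax_l X0 (Rmax (2 * (g * w)) (4 * (g * s)))) (Rmax_r X0 (Rmax (2 * (g * w)) (4 * (g * s)))).
    generalize (Rmax_l (2 * (g * w)) (4 * (g * s))) (Rmax_r (2 * (g * w)) (4 * (g * s))). lra. }
  assert (Hm2 := m_increasing X0 X2 HX0 ltac:(lra)).
  assert (H2 : s < payoff X2).
  { unfold payoff. apply Rmult_lt_reg_r with (g * (X2 + m X2)); [apply Rmult_lt_0_compat; lra|].
    unfold Rdiv. rewrite Rmult_assoc, Rinv_l by (apply Rmult_integral_contrapositive; split; lra).
    assert (m X2 * (X2 / 2) < m X2 * (X2 - g * w)) by (apply Rmult_lt_compat_l; lra).
    assert (0 < (m X2 - 4 * (g * s)) * (X2 - 4 * (g * s))) by (apply Rmult_lt_0_compat; lra).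
    assert (0 < (m X2 - 4 * (g * s)) * X2) by (apply Rmult_lt_0_compat; lra).
    assert (0 < m X2 * (X2 - 4 * (g * s))) by (apply Rmult_lt_0_compat; lra).
    lra. }
  destruct (IVT_interv (fun X => payoff X - s) X1 X2) as [X [HX HXe]]; try lra.
  - intros X HX. apply continuity_pt_minus; [|now apply continuity_pt_const].
    apply is_derive_continuity_pt with (payoff' X), payoff_derive. unfold X1 in HX. lra.
  - unfold X1. lra.
  - exists X. unfold X1 in HX. split; lra.
Qed.

Definition ratio_of_payoff (s : R) : R :=
  epsilon (inhabits 0) (fun X => g * w < X /\ payoff X = s).

(* The relative price today as a function of the relative price plus dividend
   tomorrow. The Euler equation need not determine the latter from the former. *)
Definition previous_price (s : R) : R :=
  if Rlt_dec 0 s then saving (ratio_of_payoff s) else 0.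

Let ratio_of_payoff_spec s : 0 < s -> g * w < ratio_of_payoff s /\ payoff (ratio_of_payoff s) = s.
Proof. intros Hs. unfold ratio_of_payoff. apply epsilon_spec. now apply payoff_surjective. Qed.

Lemma previous_price_0 : previous_price 0 = 0.
Proof. unfold previous_price. destruct (Rlt_dec 0 0); lra. Qed.

Lemma previous_price_payoff X : g * w < X -> previous_price (payoff X) = saving X.
Proof.
  intros HX. assert (Hs := payoff_pos X HX). unfold previous_price.
  destruct (Rlt_dec 0 (payoff X)) as [_|]; [|contradiction]. f_equal.
  destruct (ratio_of_payoff_spec _ Hs) as [H1 H2].
  destruct (Rtotal_order (ratio_of_payoff (payoff X)) X) as [H|[H|H]]; [|exact H|].
  - apply payoff_increasing in H; lra.
  - apply payoff_increasing in H; lra.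
Qed.

Lemma previous_price_pos s : 0 < s -> 0 < previous_price s.
Proof.
  intros Hs. destruct (payoff_surjective s Hs) as [X [HX <-]].
  rewrite previous_price_payoff by exact HX. now apply saving_bounds.
Qed.

Lemma previous_price_nonneg s : 0 <= s -> 0 <= previous_price s.
Proof.
  intros [Hs|<-]; [now apply Rlt_le, previous_price_pos|]. rewrite previous_price_0. lra.
Qed.

Lemma previous_price_lt_1 s : previous_price s < 1.
Proof.
  unfold previous_price. destruct (Rlt_dec 0 s) as [Hs|]; [|lra].
  apply saving_bounds, ratio_of_payoff_spec, Hs.
Qed.

Lemma euler_iff_previous_price p s : 0 < s ->
  (0 < p < 1 /\ m (g * (w + s) / (1 - p)) * p = g * s) <-> p = previous_price s.
Proof.
  intros Hs. split.
  - intros [Hp He]. set (X := g * (w + s) / (1 - p)) in *.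
    assert (HX : X * (1 - p) = g * w + g * s) by (unfold X; field; lra).
    assert (HGs : 0 < g * s) by (now apply Rmult_lt_0_compat).
    assert (HGX : g * w < X) by nra. assert (Hm := m_pos X ltac:(lra)).
    assert (Hpe : p = saving X).
    { unfold saving. apply Rmult_eq_reg_r with (X + m X); [|lra].
      unfold Rdiv. rewrite Rmult_assoc, Rinv_l by lra. lra. }
    assert (Hse : s = payoff X).
    { apply Rmult_eq_reg_l with g; [|lra]. rewrite payoff_saving by exact HGX. rewrite <- Hpe. lra. }
    rewrite Hse, previous_price_payoff by exact HGX. exact Hpe.
  - destruct (payoff_surjective s Hs) as [X [HGX <-]].
    rewrite previous_price_payoff by exact HGX. intros ->.
    assert (Hb := saving_bounds X HGX). split; [exact Hb|].
    replace (g * (w + payoff X) / (1 - saving X)) with X; [now rewrite payoff_saving|].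
    assert (Hm := m_pos X ltac:(lra)).
    apply Rmult_eq_reg_r with (1 - saving X); [|lra].
    replace (g * (w + payoff X) / (1 - saving X) * (1 - saving X)) with (g * w + g * payoff X) by (field; lra).
    rewrite payoff_saving by exact HGX. unfold saving. field. lra.
Qed.

(** [payoff] is increasing, so closeness of payoffs forces closeness of X. The margin [d2] excludes
    s = 0 unless X0 = g w, where the default value of [previous_price] at 0 agrees with [saving];
    [d3] matters only if X0 - eta is above g w, since otherwise X > g w already bounds X from
    below. *)
Let payoff_local_inverse X0 eta : 0 < X0 -> g * w <= X0 -> 0 < eta ->
  exists delta, 0 < delta /\ forall s, 0 <= s -> Rabs (s - payoff X0) <= delta ->
    exists X, Rabs (X - X0) < eta /\ payoff X = s /\ previous_price s = saving X.
Proof.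
  intros HX0 HwX0 Heta.
  assert (H1 := payoff_increasing X0 (X0 + eta) HX0 HwX0 ltac:(lra)).
  set (d1 := payoff (X0 + eta) - payoff X0).
  set (d2 := if Rlt_dec (g * w) X0 then payoff X0 else 1).
  set (d3 := if Rlt_dec (g * w) (X0 - eta) then payoff X0 - payoff (X0 - eta) else 1).
  assert (Hd2 : 0 < d2).
  { unfold d2. destruct (Rlt_dec (g * w) X0); [now apply payoff_pos|lra]. }
  assert (Hd3 : 0 < d3).
  { unfold d3. destruct (Rlt_dec (g * w) (X0 - eta)); [|lra].
    assert (payoff (X0 - eta) < payoff X0) by (apply payoff_increasing; lra). lra. }
  set (delta := Rmin d1 (Rmin d2 d3) / 2).
  assert (Hdelta : 0 < delta /\ delta < d1 /\ delta < d2 /\ delta < d3).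
  { assert (0 < Rmin d1 (Rmin d2 d3)) by (repeat apply Rmin_glb_lt; unfold d1; lra).
    unfold delta. generalize (Rmin_l d1 (Rmin d2 d3)) (Rmin_r d1 (Rmin d2 d3)) (Rmin_l d2 d3) (Rmin_r d2 d3). lra. }
  exists delta. split; [tauto|]. intros s Hs Hsd. apply Rabs_le_between in Hsd.
  destruct Hs as [Hs|<-].
  - destruct (payoff_surjective s Hs) as [X [HX HXs]]. exists X.
    split; [|split; [exact HXs|now rewrite <- HXs, previous_price_payoff]].
    apply Rabs_lt_between. split; apply Rnot_le_lt; intros Hle.
    + assert (Hlt : g * w < X0 - eta) by lra. unfold d3 in Hdelta.
      destruct (Rlt_dec (g * w) (X0 - eta)); [|contradiction].
      assert (payoff X <= payoff (X0 - eta)).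
      { destruct (Req_dec X (X0 - eta)) as [->|]; [lra|]. apply Rlt_le, payoff_increasing; lra. }
      lra.
    + assert (payoff (X0 + eta) <= payoff X).
      { destruct (Req_dec X (X0 + eta)) as [->|]; [lra|]. apply Rlt_le, payoff_increasing; lra. }
      unfold d1 in Hdelta. lra.
  - unfold d2 in Hdelta. destruct (Rlt_dec (g * w) X0) as [|Hn]; [lra|].
    assert (X0 = g * w) as -> by lra. exists (g * w).
    rewrite Rminus_diag_eq, Rabs_R0 by reflexivity.
    split; [exact Heta|]. split; [apply payoff_Gw|]. now rewrite previous_price_0, saving_Gw.
Qed.

(** Along the curve X -> (payoff X, saving X) both coordinates are strictly differentiable, and the
    slope of the curve is the quotient of their derivatives because [payoff'] does not vanish at
    X0. *)
Lemma previous_price_strict_derivative X0 : 0 < X0 -> g * w <= X0 ->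
  strict_derivative previous_price (payoff X0) (saving' X0 / payoff' X0).
Proof.
  intros HX0 HwX0 eps Heps. set (sg := payoff' X0). set (c := saving' X0 / sg).
  assert (Hsg : 0 < sg) by (now apply payoff'_pos).
  assert (Hc : 0 < 1 + Rabs c) by (generalize (Rabs_pos c); lra).
  (* The first bound makes |ds| at least sg / 2 |dx|; the second keeps the combined error e1 (1 +
     |c|) |dx| below eps |ds|. *)
  set (e1 := Rmin (sg / 2) (eps * sg / (2 * (1 + Rabs c)))).
  assert (He1 : 0 < e1 /\ e1 <= sg / 2 /\ e1 * (1 + Rabs c) <= eps * sg / 2).
  { unfold e1. split; [|split; [apply Rmin_l|]].
    - apply Rmin_glb_lt; [lra|]. apply Rdiv_lt_0_compat; [apply Rmult_lt_0_compat|]; lra.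
    - apply Rle_trans with (eps * sg / (2 * (1 + Rabs c)) * (1 + Rabs c)).
      + apply Rmult_le_compat_r; [lra|apply Rmin_r].
      + right. field. lra. }
  destruct (increment_of_continuous_derivative saving saving' X0 e1) as [d1 [Hd1 H1]]; auto; try tauto.
  { apply saving_derive. }
  destruct (increment_of_continuous_derivative payoff payoff' X0 e1) as [d2 [Hd2 H2]]; auto; try tauto.
  { apply payoff_derive. }
  destruct (payoff_local_inverse X0 (Rmin d1 d2)) as [delta [Hdelta Hinv]]; auto; [now apply Rmin_glb_lt|].
  exists delta. split; [exact Hdelta|]. intros x y Hx Hy Hxd Hyd.
  destruct (Hinv x Hx Hxd) as [X [HX [<- ->]]]. destruct (Hinv y Hy Hyd) as [Y [HY [<- ->]]].
  generalize (Rmin_l d1 d2) (Rmin_r d1 d2). intros B1 B2.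
  specialize (H1 X Y ltac:(lra) ltac:(lra)). specialize (H2 X Y ltac:(lra) ltac:(lra)). fold sg in H2.
  set (ds := payoff X - payoff Y) in *. set (dp := saving X - saving Y) in *. set (dx := X - Y) in *.
  assert (Hdx : sg / 2 * Rabs dx <= Rabs ds).
  { assert (Rabs (sg * dx) <= Rabs ds + e1 * Rabs dx).
    { replace (sg * dx) with (ds + - (ds - sg * dx)) by ring.
      apply Rle_trans with (1 := Rabs_triang _ _). rewrite Rabs_Ropp. lra. }
    rewrite Rabs_mult, (Rabs_pos_eq sg) in H by lra.
    assert (e1 * Rabs dx <= sg / 2 * Rabs dx) by (apply Rmult_le_compat_r; [apply Rabs_pos|tauto]). lra. }
  replace (dp - c * ds) with ((dp - saving' X0 * dx) + - (c * (ds - sg * dx))) by (unfold c; field; lra).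
  apply Rle_trans with (1 := Rabs_triang _ _). rewrite Rabs_Ropp, Rabs_mult.
  apply Rle_trans with (e1 * (1 + Rabs c) * Rabs dx).
  - apply (Rmult_le_compat_l (Rabs c)) in H2; [|apply Rabs_pos]. lra.
  - apply Rle_trans with (eps * sg / 2 * Rabs dx).
    + apply Rmult_le_compat_r; [apply Rabs_pos|tauto].
    + apply (Rmult_le_compat_l eps) in Hdx; lra.
Qed.

Lemma previous_price_strict_derivative_0 : 0 < w ->
  strict_derivative previous_price 0 (g / m (g * w)).
Proof.
  intros Hw. assert (HGw : 0 < g * w) by (now apply Rmult_lt_0_compat). assert (Hm := m_pos _ HGw).
  generalize (previous_price_strict_derivative (g * w) HGw (Rle_refl _)). rewrite payoff_Gw.
  replace (saving' (g * w) / payoff' (g * w)) with (g / m (g * w)); [tauto|].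
  unfold saving', payoff'. replace (g * w - g * w) with 0 by ring. field. repeat split; nra.
Qed.

(** A small price alone does not force a small payoff, since [saving] may fall again at large X. The
    cap [S] bounds X + m(X), and then a small price forces X < X1, where m is below m(X1). *)
Lemma payoff_le_of_small_price X1 S : g * w < X1 -> 0 < S ->
  exists delta, 0 < delta /\ forall s, 0 < s < S -> previous_price s < delta ->
    g * s <= m X1 * previous_price s.
Proof.
  intros HX1 HS. destruct (payoff_surjective S HS) as [X2 [HX2 HX2S]].
  assert (Hm2 := m_pos X2 ltac:(lra)).
  exists ((X1 - g * w) / (X2 + m X2)). split; [apply Rdiv_lt_0_compat; lra|].
  intros s Hs Hp. destruct (payoff_surjective s (proj1 Hs)) as [X [HX HXs]]. subst s.
  rewrite previous_price_payoff in * by exact HX. rewrite payoff_saving by exact HX.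
  assert (Hm := m_pos X ltac:(lra)).
  assert (HXX2 : X < X2).
  { apply Rnot_le_lt. intros [H|H]; [apply payoff_increasing in H; lra|subst X2; lra]. }
  assert (HmX2 := m_increasing X X2 ltac:(lra) HXX2).
  apply Rmult_le_compat_r; [apply Rlt_le, saving_bounds, HX|].
  assert (HXX1 : X < X1).
  { assert (H : saving X * (X + m X) = X - g * w) by (unfold saving; field; lra).
    assert (Hs1 := saving_bounds X HX).
    apply (Rmult_lt_compat_r (X2 + m X2)) in Hp; [|lra].
    replace ((X1 - g * w) / (X2 + m X2) * (X2 + m X2)) with (X1 - g * w) in Hp by (field; lra). nra. }
  apply Rlt_le, m_increasing; lra.
Qed.

(** At X = g wb the marginal rate of substitution equals g, so [payoff] and [saving] coincide
    there. *)
Lemma previous_price_bubble_steady_state wb : w < wb -> m (g * wb) = g ->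
  0 < (wb - w) / (wb + 1) /\ previous_price ((wb - w) / (wb + 1)) = (wb - w) / (wb + 1) /\
  exists c, strict_derivative previous_price ((wb - w) / (wb + 1)) c.
Proof.
  intros Hwb Hm.
  assert (HX : g * w < g * wb) by (apply Rmult_lt_compat_l; lra).
  assert (E1 : payoff (g * wb) = (wb - w) / (wb + 1)) by (unfold payoff; rewrite Hm; field; lra).
  assert (E2 : saving (g * wb) = (wb - w) / (wb + 1)) by (unfold saving; rewrite Hm; field; lra).
  split; [apply Rdiv_lt_0_compat; lra|]. split.
  - rewrite <- E1 at 1. rewrite <- E2. now apply previous_price_payoff.
  - rewrite <- E1. exists (saving' (g * wb) / payoff' (g * wb)). apply previous_price_strict_derivative; lra.
Qed.
End Backward.

(** * Equilibria *)

Section Equilibria.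
Variable e : economy.
Local Notation phi := (previous_price e).
Local Notation d0 := (Defs.D e / a e).
Local Notation rho := (Gd e / G e).
Local Notation d := (geom d0 rho).
Local Notation m := (ray_mrs (util e)).
Local Notation w := (income_ratio e).

Let G0 : 0 < G e. Proof. apply G_pos. Qed.
Let Gd0 : 0 < Gd e. Proof. apply Gd_pos. Qed.
Let Gd_G : Gd e < G e. Proof. apply Gd_lt_G. Qed.
Let a0 : 0 < a e. Proof. apply a_pos. Qed.
Let b0 : 0 <= b e. Proof. apply b_nonneg. Qed.
Let D0 : 0 < Defs.D e. Proof. apply D_pos. Qed.
Let Gt t : 0 < G e ^ t. Proof. now apply pow_lt. Qed.
Let Gdt t : 0 < Gd e ^ t. Proof. now apply pow_lt. Qed.

Let d0_pos : 0 < d0.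
Proof. now apply Rdiv_lt_0_compat. Qed.

Let rho_bounds : 0 < rho < 1.
Proof.
  split; [now apply Rdiv_lt_0_compat|]. apply Rmult_lt_reg_r with (G e); [exact G0|].
  unfold Rdiv. rewrite Rmult_assoc, Rinv_l; lra.
Qed.

Let d_pos t : 0 < d t.
Proof. apply geom_pos; tauto. Qed.

Let young_pos t : 0 < young_endowment e t.
Proof. now apply Rmult_lt_0_compat. Qed.

Let dividend_pos t : 0 < dividend e t.
Proof. now apply Rmult_lt_0_compat. Qed.

Let dividend_eq t : dividend e t = young_endowment e t * d t.
Proof.
  unfold dividend, young_endowment, geom. unfold Rdiv at 2. rewrite Rpow_mult_distr, pow_inv.
  field. split; [apply pow_nonzero; lra|lra].
Qed.

Let old_eq t : old_endowment e t = young_endowment e t * w.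
Proof. unfold old_endowment, young_endowment, income_ratio. field. lra. Qed.

Let young_S t : young_endowment e (S t) = G e * young_endowment e t.
Proof. unfold young_endowment. simpl. ring. Qed.

Definition path_of_relative_price (p : nat -> R) : path := {|
  price := fun t => young_endowment e t * p t;
  holding := fun _ => 1;
  cons_young := fun t => young_endowment e t - young_endowment e t * p t;
  cons_old := fun t => old_endowment e t + young_endowment e t * p t + dividend e t |}.

Let optimal_iff_previous_price (p : nat -> R) t : 0 < p t -> 0 < p (S t) ->
  optimal_choice e (price (path_of_relative_price p)) t 1
    (cons_young (path_of_relative_price p) t) (cons_old (path_of_relative_price p) (S t))
  <-> p t = phi (p (S t) + d (S t)).
Proof.
  intros Hp HpS. simpl.
  set (A := young_endowment e t). set (A' := young_endowment e (S t)).
  assert (HA : 0 < A) by apply young_pos. assert (HA' : 0 < A') by apply young_pos.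
  set (P := fun t => young_endowment e t * p t).
  set (y := A - A * p t). set (z := old_endowment e (S t) + A' * p (S t) + dividend e (S t)).
  set (s := p (S t) + d (S t)).
  assert (Hs : 0 < s) by (unfold s; generalize (d_pos (S t)); lra).
  assert (HQ : P (S t) + dividend e (S t) = A' * s).
  { unfold P. rewrite dividend_eq. fold A'. unfold s. ring. }
  assert (HQ0 : 0 < A' * s) by (now apply Rmult_lt_0_compat).
  assert (HP : P t = A * p t) by reflexivity.
  assert (HP0 : 0 < A * p t) by (now apply Rmult_lt_0_compat).
  assert (Hz : z = A' * (w + s)).
  { unfold z. rewrite old_eq, dividend_eq. fold A'. unfold s. ring. }
  assert (Hz0 : 0 < z).
  { rewrite Hz. apply Rmult_lt_0_compat; [exact HA'|]. generalize (income_ratio_nonneg e). lra. }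
  assert (Hzold : z = old_endowment e (S t) + A' * s) by (rewrite Hz, old_eq; fold A'; ring).
  assert (Hy : y = A * (1 - p t)) by (unfold y; ring).
  assert (Heuler : 0 < y -> (m (z / y) * (A * p t) = A' * s <-> m (G e * (w + s) / (1 - p t)) * p t = G e * s)).
  { intros Hy0. assert (H1p : 0 < 1 - p t) by (rewrite Hy in Hy0; nra).
    assert (HA'e : A' = G e * A) by apply young_S.
    replace (z / y) with (G e * (w + s) / (1 - p t)) by (rewrite Hz, Hy, HA'e; field; lra).
    rewrite HA'e. split; intros H.
    - apply Rmult_eq_reg_l with A; lra.
    - apply (Rmult_eq_compat_l A) in H. lra. }
  rewrite <- (euler_iff_previous_price e (p t) s Hs).
  assert (Hopt : 0 < y -> ((forall x' y' z', budget e P t x' y' z' -> util e y' z' <= util e y z)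
                  <-> m (z / y) * (A * p t) = A' * s)).
  { intros Hy0. rewrite <- (optimal_iff_euler (util e) (util_standard e) y z (A * p t) (A' * s)) by assumption.
    split.
    - intros H x Hx1 Hx2. apply (H x). unfold budget. rewrite HQ, HP. repeat split; auto.
      + unfold y. fold A. ring.
      + lra.
    - intros H x' y' z' [H1 [H2 [H3 H4]]]. rewrite HQ in H4. rewrite HP in H3. fold A in H3.
      specialize (H x'). replace (y + A * p t - A * p t * x') with y' in H by (unfold y; lra).
      replace (z - A' * s + A' * s * x') with z' in H by lra. auto. }
  split.
  - intros [[Hy0 [_ _]] Hmax].
    assert (H1p : p t < 1) by (rewrite Hy in Hy0; nra). split; [lra|]. apply Heuler; [exact Hy0|]. now apply Hopt.
  - intros [Hp1 HE]. assert (Hy0 : 0 < y) by (rewrite Hy; apply Rmult_lt_0_compat; lra). split.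
    + repeat split; auto.
      * unfold y. fold A. rewrite HP. ring.
      * fold (P (S t)). rewrite HQ. lra.
    + apply Hopt; [exact Hy0|]. now apply Heuler.
Qed.

Lemma equilibrium_iff_orbit E : equilibrium e E <->
  exists p, orbit_from phi d 0 p /\ E = path_of_relative_price p.
Proof.
  split.
  - intros HE. set (p := fun t => price E t / young_endowment e t).
    assert (HEp : E = path_of_relative_price p).
    { assert (H1 : forall t, price E t = young_endowment e t * p t).
      { intros t. unfold p. generalize (young_pos t). intros. field. lra. }
      assert (H2 : forall t, holding E t = 1) by apply HE.
      assert (H3 : forall t, cons_young E t = young_endowment e t - young_endowment e t * p t).
      { intros t. destruct (HE t) as [_ [[[_ [_ [Hb _]]] _] [Hh _]]]. rewrite Hh, H1 in Hb. lra. }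
      (* Market clearing is used rather than the budget, which says nothing about the old at date
         0. *)
      assert (H4 : forall t, cons_old E t = old_endowment e t + young_endowment e t * p t + dividend e t).
      { intros t. destruct (HE t) as [_ [_ [_ Hm]]]. rewrite H3 in Hm. lra. }
      destruct E as [P x y z]. simpl in *. unfold path_of_relative_price.
      f_equal; apply functional_extensionality; assumption. }
    exists p. split; [|exact HEp]. intros t _.
    assert (Hp : forall t, 0 < p t) by (intros u; apply Rdiv_lt_0_compat; [apply HE|apply young_pos]).
    split; [apply Hp|]. apply optimal_iff_previous_price; auto.
    destruct (HE t) as [_ [Ho [Hh _]]]. rewrite Hh in Ho. rewrite HEp in Ho. exact Ho.
  - intros [p [Hp ->]] t. assert (Hpos : forall t, 0 < p t) by (intros u; apply Hp; lia).
    split; [|split; [|split]].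
    + simpl. now apply Rmult_lt_0_compat.
    + apply optimal_iff_previous_price; auto. apply Hp. lia.
    + reflexivity.
    + simpl. ring.
Qed.

Lemma path_of_relative_price_eq p q : (forall t, p t = q t) ->
  path_of_relative_price p = path_of_relative_price q.
Proof. intros H. now replace q with p by (now apply functional_extensionality). Qed.

Let price_div_G p t : price (path_of_relative_price p) t / G e ^ t = a e * p t.
Proof. simpl. unfold young_endowment. field. apply pow_nonzero. lra. Qed.

Let price_div_Gd p t : price (path_of_relative_price p) t / Gd e ^ t = Defs.D e * (p t / d t).
Proof.
  assert (Hd := d_pos t). apply Rmult_eq_reg_r with (Gd e ^ t); [|apply pow_nonzero; lra].
  replace (Defs.D e * (p t / d t) * Gd e ^ t) with (dividend e t * (p t / d t)) by (unfold dividend; ring).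
  rewrite dividend_eq. simpl. field. split; [lra|apply pow_nonzero; lra].
Qed.

Lemma negligible_iff p : negligible_at_rate (G e) (path_of_relative_price p) <-> is_lim_seq p 0.
Proof.
  unfold negligible_at_rate. split; intros H.
  - apply is_lim_seq_ext with (fun t => / a e * (price (path_of_relative_price p) t / G e ^ t)).
    { intros t. rewrite price_div_G. field. lra. }
    evar_last; [apply is_lim_seq_scal_l, H|]. simpl. now rewrite Rmult_0_r.
  - apply is_lim_seq_ext with (fun t => a e * p t).
    { intros t. now rewrite price_div_G. }
    evar_last; [apply is_lim_seq_scal_l, H|]. simpl. now rewrite Rmult_0_r.
Qed.

Lemma grows_at_rate_G p x0 : 0 < x0 -> is_lim_seq p x0 -> grows_at_rate (G e) (path_of_relative_price p).
Proof.
  intros Hx0 H. exists (a e * x0). split; [now apply Rmult_lt_0_compat|].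
  apply is_lim_seq_ext with (fun t => a e * p t).
  { intros t. now rewrite price_div_G. }
  apply (is_lim_seq_scal_l p (a e) x0), H.
Qed.

Lemma grows_at_rate_Gd p v : 0 < v -> is_lim_seq (fun t => p t / d t) v ->
  grows_at_rate (Gd e) (path_of_relative_price p).
Proof.
  intros Hv H. exists (Defs.D e * v). split; [now apply Rmult_lt_0_compat|].
  apply is_lim_seq_ext with (fun t => Defs.D e * (p t / d t)).
  { intros t. now rewrite price_div_Gd. }
  apply (is_lim_seq_scal_l _ (Defs.D e) v), H.
Qed.

Lemma grows_at_rate_Gd_bound p : grows_at_rate (Gd e) (path_of_relative_price p) ->
  exists M T, forall t, (T <= t)%nat -> p t <= M * d t.
Proof.
  intros [v [Hv H]]. apply is_lim_seq_spec in H. destruct (H (mkposreal _ Hv)) as [T HT].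
  exists (2 * v / Defs.D e), T. intros t Ht. specialize (HT t Ht). simpl pos in HT.
  rewrite price_div_Gd in HT. apply Rabs_lt_between in HT. assert (Hd := d_pos t).
  apply Rmult_le_reg_l with (Defs.D e / d t); [now apply Rdiv_lt_0_compat|].
  replace (Defs.D e / d t * p t) with (Defs.D e * (p t / d t)) by (field; lra).
  replace (Defs.D e / d t * (2 * v / Defs.D e * d t)) with (2 * v) by (field; lra). lra.
Qed.

(** * Discounted prices and the bubble component *)

Section Bubble.
Variable P : nat -> R.
Hypothesis P_pos : forall t, 0 < P t.
Local Notation q := (date0_price e P).
Let B (t : nat) : R := q t * P t.

Let q_pos t : 0 < q t.
Proof.
  induction t as [|t IH]; simpl; [lra|]. apply Rdiv_lt_0_compat; [exact IH|].
  unfold gross_return. apply Rdiv_lt_0_compat; [|apply P_pos].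
  generalize (P_pos (S t)) (dividend_pos (S t)). lra.
Qed.

Let B_pos t : 0 < B t.
Proof. apply Rmult_lt_0_compat; [apply q_pos|apply P_pos]. Qed.

Let B_step t : B t = B (S t) + q (S t) * dividend e (S t).
Proof.
  unfold B. simpl. unfold gross_return. generalize (P_pos t) (P_pos (S t)) (dividend_pos (S t)).
  intros. field. lra.
Qed.

Let B_antitone t n : B (t + n) <= B t.
Proof.
  induction n as [|n IH]; [rewrite Nat.add_0_r; lra|]. rewrite Nat.add_succ_r.
  generalize (B_step (t + n)) (Rmult_lt_0_compat _ _ (q_pos (S (t + n))) (dividend_pos (S (t + n)))). lra.
Qed.

(** Discounted dividends are the successive decrements of [B], so their sum telescopes; the limit of
    [B] is the bubble valued at date 0. *)
Let fundamental_value_eq (L : R) t : is_lim_seq B L -> fundamental_value e P t = P t - L / q t.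
Proof.
  intros HL. unfold fundamental_value.
  rewrite (is_series_unique _ (B t - L)).
  - unfold B. generalize (q_pos t). intros. field. lra.
  - change (is_lim_seq (sum_n (fun k => q (S t + k) * dividend e (S t + k))) (B t - L)).
    apply is_lim_seq_ext with (fun n => B t - B (S t + n)%nat).
    + induction n as [|n IH].
      * rewrite sum_O, Nat.add_0_r. generalize (B_step t). lra.
      * rewrite sum_Sn, <- IH, Nat.add_succ_r. set (k := (S t + n)%nat).
        change (B t - B (S k) = B t - B k + q (S k) * dividend e (S k)).
        generalize (B_step k). lra.
    + apply is_lim_seq_minus'; [apply is_lim_seq_const|].
      apply is_lim_seq_ext with (fun n => B (n + S t)%nat); [intros n; f_equal; lia|].
      apply (is_lim_seq_incr_n B (S t) L). exact HL.
Qed.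

Let B_lim : exists L : R, is_lim_seq B L /\ 0 <= L.
Proof.
  destruct (ex_finite_lim_seq_decr B 0) as [L HL].
  - intros n. generalize (B_antitone n 1). now rewrite Nat.add_1_r.
  - intros n. apply Rlt_le, B_pos.
  - exists L. split; [exact HL|].
    apply (is_lim_seq_le (fun _ => 0) B 0 L); [intros; apply Rlt_le, B_pos|apply is_lim_seq_const|exact HL].
Qed.

(** A dividend yield decaying geometrically takes only a summable fraction out of [B]: from a late
    date N on, the total loss is at most half of [B N], so the limit is positive. *)
Lemma price_gt_fundamental_value C r T : 0 < C -> 0 < r < 1 ->
  (forall t, (T <= t)%nat -> dividend e t <= C * r ^ t * P t) ->
  forall t, P t > fundamental_value e P t.
Proof.
  intros HC Hr H t. destruct B_lim as [L [HL HL0]]. rewrite (fundamental_value_eq L) by exact HL.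
  enough (0 < L) by (generalize (Rdiv_lt_0_compat _ _ H0 (q_pos t)); lra).
  (* K r^N is the sum of C r^t over all t > N. *)
  set (K := C * r / (1 - r)).
  assert (HK : 0 < K) by (apply Rdiv_lt_0_compat; [apply Rmult_lt_0_compat|]; lra).
  assert (HKe : K * (1 - r) = C * r) by (unfold K; field; lra).
  destruct (exists_pow_small r (/ (2 * K))) as [T' HT']; [lra|apply Rinv_0_lt_compat; lra|].
  set (N := (T + T')%nat).
  assert (HN : K * r ^ N <= 1 / 2).
  { specialize (HT' N ltac:(unfold N; lia)). apply (Rmult_lt_compat_l K) in HT'; [|exact HK].
    replace (K * / (2 * K)) with (1 / 2) in HT' by (field; lra). lra. }
  assert (Hlow : forall n, B N * (1 - K * r ^ N + K * r ^ (N + n)) <= B (N + n)).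
  { induction n as [|n IH]; [rewrite Nat.add_0_r; lra|].
    rewrite Nat.add_succ_r. set (u := (N + n)%nat) in *.
    assert (Hd : q (S u) * dividend e (S u) <= B N * (C * r * r ^ u)).
    { apply Rle_trans with (q (S u) * (C * r ^ S u * P (S u))).
      - apply Rmult_le_compat_l; [apply Rlt_le, q_pos|]. apply H. unfold u, N. lia.
      - replace (q (S u) * (C * r ^ S u * P (S u))) with (B (S u) * (C * r * r ^ u)) by (unfold B; simpl; ring).
        apply Rmult_le_compat_r.
        + apply Rmult_le_pos; [apply Rmult_le_pos; lra|apply pow_le; lra].
        + unfold u. rewrite <- Nat.add_succ_r. apply B_antitone. }
    generalize (B_step u). intros HB.
    simpl pow. rewrite <- HKe in Hd. lra. }
  apply Rlt_le_trans with (B N * (1 / 2)); [generalize (B_pos N); lra|].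
  apply (is_lim_seq_le (fun _ => B N * (1 / 2)) (fun n => B (n + N)%nat) (B N * (1 / 2)) L).
  - intros n. rewrite Nat.add_comm. apply Rle_trans with (2 := Hlow n).
    apply Rmult_le_compat_l; [apply Rlt_le, B_pos|].
    assert (0 <= K * r ^ (N + n)) by (apply Rmult_le_pos; [lra|apply pow_le; lra]). lra.
  - apply is_lim_seq_const.
  - apply (is_lim_seq_incr_n B N L). exact HL.
Qed.

(** A dividend yield bounded away from 0 divides [B] by at least 1 + c at each date, so no bubble
    component survives. *)
Lemma price_eq_fundamental_value c T : 0 < c ->
  (forall t, (T <= t)%nat -> c * P t <= dividend e t) ->
  forall t, P t = fundamental_value e P t.
Proof.
  intros Hc H t. rewrite (fundamental_value_eq 0); [unfold Rdiv; ring|].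
  assert (Hr : 0 < / (1 + c) < 1).
  { split; [apply Rinv_0_lt_compat; lra|]. rewrite <- Rinv_1 at 2. apply Rinv_lt_contravar; lra. }
  apply is_lim_seq_of_geom_bound with (B T / (/ (1 + c)) ^ T) (/ (1 + c)) T; [exact Hr| |].
  { apply Rdiv_lt_0_compat; [apply B_pos|now apply pow_lt]. }
  intros u Hu. rewrite Rminus_0_r, Rabs_pos_eq by (apply Rlt_le, B_pos).
  assert (Hn : forall n, B (T + n) <= B T * (/ (1 + c)) ^ n).
  { induction n as [|n IH]; [rewrite Nat.add_0_r; simpl; lra|]. rewrite Nat.add_succ_r.
    generalize (B_step (T + n)). intros HB.
    assert (Hd : c * B (S (T + n)) <= q (S (T + n)) * dividend e (S (T + n))).
    { unfold B. rewrite <- Rmult_assoc, (Rmult_comm c), Rmult_assoc.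
      apply Rmult_le_compat_l; [apply Rlt_le, q_pos|]. apply H. lia. }
    apply Rmult_le_reg_l with (1 + c); [lra|]. simpl.
    replace ((1 + c) * (B T * (/ (1 + c) * (/ (1 + c)) ^ n))) with (B T * (/ (1 + c)) ^ n) by (field; lra). lra. }
  specialize (Hn (u - T)%nat). replace (T + (u - T))%nat with u in Hn by lia.
  apply Rle_trans with (1 := Hn). right. unfold geom.
  replace ((/ (1 + c)) ^ u) with ((/ (1 + c)) ^ T * (/ (1 + c)) ^ (u - T)) by (rewrite <- pow_add; f_equal; lia).
  field. repeat split; try apply pow_nonzero; lra.
Qed.
End Bubble.

Let price_pos p : orbit_from phi d 0 p -> forall t, 0 < price (path_of_relative_price p) t.
Proof. intros Hp t. simpl. apply Rmult_lt_0_compat; [apply young_pos|apply Hp; lia]. Qed.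

Lemma bubbly_of_summable_yield p C r T : orbit_from phi d 0 p -> 0 < C -> 0 < r < 1 ->
  (forall t, (T <= t)%nat -> d t <= C * r ^ t * p t) -> bubbly e (path_of_relative_price p).
Proof.
  intros Hp HC Hr H t. apply price_gt_fundamental_value with C r T; auto.
  intros u Hu. rewrite dividend_eq. simpl.
  replace (C * r ^ u * (young_endowment e u * p u)) with (young_endowment e u * (C * r ^ u * p u)) by ring.
  apply Rmult_le_compat_l; [apply Rlt_le, young_pos|now apply H].
Qed.

Lemma bubbly_of_price_bounded_below p delta T : orbit_from phi d 0 p -> 0 < delta ->
  (forall t, (T <= t)%nat -> delta <= p t) -> bubbly e (path_of_relative_price p).
Proof.
  intros Hp Hdelta H. apply bubbly_of_summable_yield with (d0 / delta) rho T; auto.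
  - now apply Rdiv_lt_0_compat.
  - intros t Ht. unfold geom. replace (d0 * rho ^ t) with (d0 / delta * rho ^ t * delta) by (field; lra).
    apply Rmult_le_compat_l; [|now apply H].
    apply Rmult_le_pos; [apply Rlt_le, Rdiv_lt_0_compat; lra|apply pow_le; lra].
Qed.

Lemma fundamental_of_price_bounded_by_dividend p M T : orbit_from phi d 0 p ->
  (forall t, (T <= t)%nat -> p t <= M * d t) -> fundamental e (path_of_relative_price p).
Proof.
  intros Hp H t.
  assert (HM : 0 < M).
  { generalize (H T (le_n _)) (d_pos T) (proj1 (Hp T ltac:(lia))). intros. nra. }
  apply price_eq_fundamental_value with (/ M) T; auto; [now apply Rinv_0_lt_compat|].
  intros u Hu. rewrite dividend_eq. simpl. specialize (H u Hu).
  apply Rmult_le_reg_l with M; [exact HM|].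
  replace (M * (/ M * (young_endowment e u * p u))) with (young_endowment e u * p u) by (field; lra).
  replace (M * (young_endowment e u * d u)) with (young_endowment e u * (M * d u)) by ring.
  apply Rmult_le_compat_l; [apply Rlt_le, young_pos|exact H].
Qed.

Lemma fundamental_not_bubbly E : fundamental e E -> ~ bubbly e E.
Proof. intros Hf Hb. generalize (Hf O) (Hb O). lra. Qed.

(* Below X1 prices shrink faster than dividends, so a price that once becomes
   small would fall below the dividends it has to pay. *)
Lemma orbit_bounded_below p X1 : G e * w < X1 -> m X1 < Gd e -> orbit_from phi d 0 p ->
  exists delta, 0 < delta /\ forall t, delta <= p t.
Proof.
  intros HX1 Hm Hp.
  destruct (payoff_le_of_small_price e X1 (1 + d0) HX1 ltac:(lra)) as [delta [Hdelta Hb]].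
  exists delta. split; [exact Hdelta|]. intros T. apply Rnot_lt_le. intros HT.
  assert (HX0 : 0 < X1).
  { apply Rle_lt_trans with (2 := HX1). apply Rmult_le_pos; [lra|apply income_ratio_nonneg]. }
  assert (Hm0 := ray_mrs_pos (util e) (util_standard e) X1 HX0).
  set (r := m X1 / G e).
  assert (Hr : 0 < r < rho).
  { split; [now apply Rdiv_lt_0_compat|]. apply Rmult_lt_compat_r; [now apply Rinv_0_lt_compat|exact Hm]. }
  assert (Hpos : forall t, 0 < p t) by (intros t; apply Hp; lia).
  assert (Hlt1 : forall t, p t < 1).
  { intros t. rewrite (proj2 (Hp t ltac:(lia))). apply previous_price_lt_1. }
  assert (Hstep : forall t, p t < delta -> p (S t) + d (S t) <= r * p t).
  { intros t Ht. rewrite (proj2 (Hp t ltac:(lia))) in Ht.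
    assert (Hd := d_pos (S t)). assert (Hp1 := Hlt1 (S t)). assert (Hp2 := Hpos (S t)).
    assert (Hd0 : d (S t) <= d0).
    { unfold geom. rewrite <- (Rmult_1_r d0) at 2. apply Rmult_le_compat_l; [lra|].
      rewrite <- (pow1 (S t)). apply pow_incr. lra. }
    specialize (Hb (p (S t) + d (S t)) ltac:(lra) Ht).
    rewrite <- (proj2 (Hp t ltac:(lia))) in Hb.
    apply Rmult_le_reg_l with (G e); [exact G0|]. unfold r.
    replace (G e * (m X1 / G e * p t)) with (m X1 * p t) by (field; lra). exact Hb. }
  assert (Hn : forall n, p (T + n)%nat <= r ^ n * p T /\ p (T + n)%nat < delta).
  { induction n as [|n [I1 I2]]; [rewrite Nat.add_0_r; simpl; lra|]. rewrite Nat.add_succ_r.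
    assert (H1 := Hstep _ I2). assert (Hd := d_pos (S (T + n))). assert (Hp2 := Hpos (T + n)%nat).
    split; [|nra]. simpl. apply Rle_trans with (r * p (T + n)%nat); [lra|].
    rewrite Rmult_assoc. apply Rmult_le_compat_l; lra. }
  (* Prices decay at rate r < rho yet must stay above a sequence decaying at rate rho; a date N with
     (r / rho)^N small enough gives the contradiction. *)
  assert (Hq : 0 <= r / rho < 1).
  { split; [apply Rlt_le, Rdiv_lt_0_compat; lra|]. apply Rmult_lt_reg_r with rho; [lra|].
    unfold Rdiv at 1. rewrite Rmult_assoc, Rinv_l; lra. }
  assert (HdT := d_pos (S T)). assert (HpT := Hpos T).
  destruct (exists_pow_small (r / rho) (d (S T) / (r * p T)) Hq) as [N HN].
  { apply Rdiv_lt_0_compat; [exact HdT|]. apply Rmult_lt_0_compat; lra. }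
  specialize (HN N (le_n _)).
  destruct (Hn N) as [I1 I2]. assert (H1 := Hstep _ I2). assert (Hp2 := Hpos (S (T + N))).
  assert (E1 : d (S (T + N)) = d (S T) * rho ^ N).
  { unfold geom. rewrite Rmult_assoc, <- pow_add. reflexivity. }
  assert (Hle : d (S T) * rho ^ N <= r * p T * r ^ N).
  { rewrite <- E1. apply Rle_trans with (r * p (T + N)%nat); [lra|].
    replace (r * p T * r ^ N) with (r * (r ^ N * p T)) by ring. apply Rmult_le_compat_l; lra. }
  assert (HrN : 0 < rho ^ N) by (apply pow_lt; lra).
  assert (E2 : (r / rho) ^ N * rho ^ N = r ^ N) by (rewrite <- Rpow_mult_distr; f_equal; field; lra).
  apply (Rmult_lt_compat_r (r * p T * rho ^ N)) in HN.
  2:{ apply Rmult_lt_0_compat; [apply Rmult_lt_0_compat; lra|exact HrN]. }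
  replace (d (S T) / (r * p T) * (r * p T * rho ^ N)) with (d (S T) * rho ^ N) in HN by (field; lra).
  replace ((r / rho) ^ N * (r * p T * rho ^ N)) with (r * p T * ((r / rho) ^ N * rho ^ N)) in HN by ring.
  rewrite E2 in HN. lra.
Qed.

(** * Dividend growth below the autarky interest rate m(G w) *)

Section SlowDividend.
Hypothesis Gd_lt_autarky : Gd e < m (G e * w).
Hypothesis w_pos : 0 < w.
Local Notation c := (G e / m (G e * w)).

Let Gw_pos : 0 < G e * w.
Proof. now apply Rmult_lt_0_compat. Qed.
Let m_Gw_pos : 0 < m (G e * w).
Proof. lra. Qed.
Let c_pos : 0 < c.
Proof. now apply Rdiv_lt_0_compat. Qed.
Let c_rho : c * rho < 1.
Proof.
  replace (c * rho) with (Gd e / m (G e * w)) by (field; lra).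
  apply Rmult_lt_reg_r with (m (G e * w)); [lra|]. unfold Rdiv. rewrite Rmult_assoc, Rinv_l; lra.
Qed.
Let deriv0 : strict_derivative phi 0 c.
Proof. now apply previous_price_strict_derivative_0. Qed.

Lemma grows_at_rate_Gd_iff p : orbit_from phi d 0 p ->
  grows_at_rate (Gd e) (path_of_relative_price p) <->
  exists M T, forall t, (T <= t)%nat -> p t <= M * d t.
Proof.
  intros Hp. split; [apply grows_at_rate_Gd_bound|]. intros [M [T H]].
  apply grows_at_rate_Gd with (c * rho / (1 - c * rho)).
  - apply Rdiv_lt_0_compat; [apply Rmult_lt_0_compat; lra|lra].
  - apply (orbit_decay_ratio_limit phi d0 rho) with M T; auto.
    apply previous_price_0.
Qed.

Lemma unique_equilibrium_growing_at_Gd :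
  exists Ef, unique (fun E => equilibrium e E /\ grows_at_rate (Gd e) E) Ef /\ fundamental e Ef.
Proof.
  destruct (orbit_proportional_to_decay phi d0 rho d0_pos rho_bounds (previous_price_pos e) c
    (previous_price_0 e) (previous_price_nonneg e) c_pos c_rho deriv0) as [M [p [Hp [T HpM]]]].
  exists (path_of_relative_price p). split; [split|].
  - split; [apply equilibrium_iff_orbit; now exists p|]. apply grows_at_rate_Gd_iff; eauto.
  - intros E [HE Hg]. apply equilibrium_iff_orbit in HE. destruct HE as [q [Hq ->]].
    apply grows_at_rate_Gd_iff in Hg; [|exact Hq]. destruct Hg as [M' [T' HqM]].
    apply path_of_relative_price_eq.
    (* Each orbit comes with its own multiple of the dividend and its own date; the larger multiple
       and a later date serve both. *)
    apply (orbit_proportional_to_decay_unique phi d0 rho) with c (Rmax M M') (T + T')%nat; auto.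
    + intros t Ht. apply Rle_trans with (1 := HpM t ltac:(lia)). apply Rmult_le_compat_r; [apply Rlt_le, d_pos|apply Rmax_l].
    + intros t Ht. apply Rle_trans with (1 := HqM t ltac:(lia)). apply Rmult_le_compat_r; [apply Rlt_le, d_pos|apply Rmax_r].
  - now apply fundamental_of_price_bounded_by_dividend with M T.
Qed.

Lemma negligible_of_grows_at_Gd E : equilibrium e E -> grows_at_rate (Gd e) E -> negligible_at_rate (G e) E.
Proof.
  intros HE Hg. apply equilibrium_iff_orbit in HE. destruct HE as [p [Hp ->]].
  apply negligible_iff. apply grows_at_rate_Gd_bound in Hg. destruct Hg as [M [T H]].
  assert (HM : 0 < M).
  { generalize (H T (le_n _)) (d_pos T) (proj1 (Hp T ltac:(lia))). intros. nra. }
  apply is_lim_seq_of_geom_bound with (M * d0) rho T; auto; [now apply Rmult_lt_0_compat|].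
  intros t Ht. rewrite Rminus_0_r, Rabs_pos_eq; [|apply Rlt_le, Hp; lia].
  apply Rle_trans with (1 := H t Ht). unfold geom. lra.
Qed.

Lemma negligible_dichotomy E : equilibrium e E -> negligible_at_rate (G e) E ->
  grows_at_rate (Gd e) E \/ bubbly e E.
Proof.
  intros HE Hn. apply equilibrium_iff_orbit in HE. destruct HE as [p [Hp ->]].
  rewrite negligible_iff in Hn.
  destruct (orbit_decay_dichotomy phi d0 rho d0_pos rho_bounds c (previous_price_0 e)
    c_pos c_rho deriv0 p Hp Hn) as [H|[C [r [T [HC [Hr H]]]]]].
  - left. now apply grows_at_rate_Gd_iff.
  - right. now apply bubbly_of_summable_yield with C r T.
Qed.

(** Reals inject into these equilibria through the relative price at one date [T], and the
    equilibria inject into the reals through [code]; the two injections combine to a bijection. *)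
Lemma negligible_continuum : m (G e * w) < G e ->
  is_continuum (fun E => equilibrium e E /\ negligible_at_rate (G e) E).
Proof.
  intros Hlt.
  assert (Hc1 : 1 < c).
  { apply Rmult_lt_reg_r with (m (G e * w)); [lra|]. unfold Rdiv. rewrite Rmult_assoc, Rinv_l; lra. }
  destruct (orbits_from_interval phi d0 rho d0_pos rho_bounds c (previous_price_0 e)
     c_pos c_rho deriv0 Hc1) as [l [h [T [Hlh Hx]]]].
  destruct (vanishing_orbits_encode phi d0 rho d0_pos rho_bounds c
     c_pos deriv0 (previous_price_lt_1 e)) as [code Hcode].
  (* The arctangent squeezes the real line injectively into the interval of admissible values at
     date [T]. *)
  set (x := fun r => (l + h) / 2 + (h - l) * (atan r / PI)).
  assert (Hxr : forall r, l < x r < h).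
  { intros r. unfold x. generalize (atan_bound r) PI_RGT_0. intros [B1 B2] HPI.
    assert (- (1 / 2) < atan r / PI < 1 / 2).
    { split; apply Rmult_lt_reg_r with PI; try lra; unfold Rdiv; rewrite ?Rmult_assoc, ?Rinv_l; lra. }
    nra. }
  assert (Hxinj : forall r s, x r = x s -> r = s).
  { intros r s Hrs. unfold x in Hrs. generalize PI_RGT_0. intros HPI.
    rewrite <- (tan_atan r), <- (tan_atan s). f_equal.
    assert ((h - l) * (atan r / PI) = (h - l) * (atan s / PI)) by lra.
    apply Rmult_eq_reg_l in H; [|lra]. unfold Rdiv in H. apply Rmult_eq_reg_r in H; [exact H|].
    apply Rinv_neq_0_compat. lra. }
  pose (orb := fun r => epsilon (inhabits (fun _ : nat => 0))
    (fun p => orbit_from phi d 0 p /\ p T = x r /\ is_lim_seq p 0)).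
  assert (Horb : forall r, orbit_from phi d 0 (orb r) /\ orb r T = x r /\ is_lim_seq (orb r) 0).
  { intros r. unfold orb. apply epsilon_spec. destruct (Hx (x r) (Hxr r)) as [p [Hp [HpT Hp0]]].
    destruct (orbit_extend phi d T p (previous_price_pos e) d_pos Hp) as [q [Hq Hqp]].
    exists q. split; [exact Hq|]. split; [rewrite Hqp; auto|].
    apply is_lim_seq_ext_loc with p; [|exact Hp0]. exists T. intros n Hn. symmetry. now apply Hqp. }
  destruct (@exists_bijection_of_injections path
    (fun E => equilibrium e E /\ negligible_at_rate (G e) E)
    (fun r => path_of_relative_price (orb r))
    (fun E => code (fun t => price E t / young_endowment e t))) as [f Hf].
  - intros r. destruct (Horb r) as [H1 [_ H3]]. split.
    + apply equilibrium_iff_orbit. now exists (orb r).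
    + now apply negligible_iff.
  - intros r s Hrs. apply Hxinj.
    destruct (Horb r) as [_ [<- _]]. destruct (Horb s) as [_ [<- _]].
    assert (H : price (path_of_relative_price (orb r)) T = price (path_of_relative_price (orb s)) T) by now rewrite Hrs.
    simpl in H. apply Rmult_eq_reg_l in H; [exact H|]. generalize (young_pos T). lra.
  - intros E E' [HE Hn] [HE' Hn'].
    apply equilibrium_iff_orbit in HE. destruct HE as [p [Hp ->]].
    apply equilibrium_iff_orbit in HE'. destruct HE' as [q [Hq ->]].
    rewrite negligible_iff in Hn. rewrite negligible_iff in Hn'.
    assert (Hrel : forall p, (fun t => price (path_of_relative_price p) t / young_endowment e t) = p).
    { intros u. apply functional_extensionality. intros t. simpl. generalize (young_pos t). intros. field. lra. }
    rewrite !Hrel. intros H. apply path_of_relative_price_eq. now apply Hcode.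
  - exists f. exact Hf.
Qed.
End SlowDividend.

Lemma exists_asymptotically_bubbly_equilibrium wb : w < wb -> m (G e * wb) = G e ->
  exists E, equilibrium e E /\ grows_at_rate (G e) E /\ bubbly e E.
Proof.
  intros Hwb Hm. destruct (previous_price_bubble_steady_state e wb Hwb Hm) as [Hx0 [Hfix [c Hc]]].
  set (x0 := (wb - w) / (wb + 1)) in *.
  destruct (orbit_converging_to_fixed_point phi d0 rho d0_pos rho_bounds (previous_price_pos e) x0 c
    Hx0 Hfix Hc (previous_price_nonneg e)) as [T [p [Hp Hlim]]].
  destruct (orbit_extend phi d T p (previous_price_pos e) d_pos Hp) as [q [Hq Hqp]].
  assert (Hqlim : is_lim_seq q x0).
  { apply is_lim_seq_ext_loc with p; [|exact Hlim]. exists T. intros n Hn. symmetry. now apply Hqp. }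
  exists (path_of_relative_price q). split; [apply equilibrium_iff_orbit; now exists q|].
  split; [now apply grows_at_rate_G with x0|].
  apply is_lim_seq_spec in Hqlim. destruct (Hqlim (mkposreal (x0 / 2) ltac:(lra))) as [N HN].
  apply bubbly_of_price_bounded_below with (x0 / 2) N; auto; [lra|].
  intros t Ht. specialize (HN t Ht). simpl in HN. apply Rabs_lt_between in HN. lra.
Qed.

Lemma unique_mrs_level y : 0 < y -> exists v, unique (fun v => 0 < v /\ mrs e 1 (G e * v) = y) v.
Proof.
  intros Hy. destruct (ray_mrs_surjective (util e) (util_standard e) y Hy) as [X [HX HXy]].
  exists (X / G e). split.
  - split; [now apply Rdiv_lt_0_compat|]. replace (G e * (X / G e)) with X by (field; lra). exact HXy.
  - intros v [Hv Hvy]. change (m (G e * v) = y) in Hvy.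
    assert (HGv : 0 < G e * v) by (now apply Rmult_lt_0_compat).
    apply Rmult_eq_reg_l with (G e); [|lra]. replace (G e * (X / G e)) with X by (field; lra).
    destruct (Rtotal_order X (G e * v)) as [H|[H|H]]; [|exact H|];
      apply (ray_mrs_increasing (util e) (util_standard e)) in H; lra.
Qed.
End Equilibria.

Theorem theorem2 (e : economy) :
  exists wf wb : R,
    unique (fun w => 0 < w /\ mrs e 1 (G e * w) = Gd e) wf /\
    unique (fun w => 0 < w /\ mrs e 1 (G e * w) = G e) wb /\
    wf < wb /\
    (wf < income_ratio e ->
       exists Ef : path,
         unique (fun E => equilibrium e E /\ grows_at_rate (Gd e) E) Ef /\
         fundamental e Ef) /\
    (income_ratio e < wb ->
       (exists E : path,
          equilibrium e E /\ grows_at_rate (G e) E /\ bubbly e E) /\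
       (income_ratio e < wf ->
          ~ exists E : path, equilibrium e E /\ fundamental e E)) /\
    (wf < income_ratio e < wb ->
       exists Ef : path,
         unique (fun E => equilibrium e E /\ grows_at_rate (Gd e) E) Ef /\
         is_continuum (fun E => equilibrium e E /\ negligible_at_rate (G e) E) /\
         (equilibrium e Ef /\ negligible_at_rate (G e) Ef) /\
         (forall E : path, equilibrium e E -> negligible_at_rate (G e) E ->
            (bubbly e E <-> E <> Ef))).
Proof.
  destruct (unique_mrs_level e (Gd e) (Gd_pos e)) as [wf Hwf].
  destruct (unique_mrs_level e (G e) (G_pos e)) as [wb Hwb].
  exists wf, wb. split; [exact Hwf|]. split; [exact Hwb|].
  destruct Hwf as [[Hwf0 Hwf] _]. destruct Hwb as [[Hwb0 Hwb] _].
  change (ray_mrs (util e) (G e * wf) = Gd e) in Hwf. change (ray_mrs (util e) (G e * wb) = G e) in Hwb.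
  assert (HG := G_pos e). assert (HGd := Gd_lt_G e).
  assert (Hmono : forall u v, 0 < u -> u < v -> ray_mrs (util e) (G e * u) < ray_mrs (util e) (G e * v)).
  { intros u v Hu Huv. apply (ray_mrs_increasing (util e) (util_standard e)).
    - now apply Rmult_lt_0_compat.
    - now apply Rmult_lt_compat_l. }
  split; [|split; [|split]].
  - apply Rnot_le_lt. intros [H|H]; [apply Hmono in H; lra|subst; lra].
  - intros Hw. apply unique_equilibrium_growing_at_Gd; [|lra]. rewrite <- Hwf. now apply Hmono.
  - intros Hw. split; [now apply exists_asymptotically_bubbly_equilibrium with wb|].
    intros Hwf' [E [HE Hf]]. apply (fundamental_not_bubbly e E Hf).
    apply equilibrium_iff_orbit in HE. destruct HE as [p [Hp ->]].
    (* A level strictly between w and wf: m(G v) is below [Gd], and G v is positive even when w =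
       0. *)
    set (v := (income_ratio e + wf) / 2). generalize (income_ratio_nonneg e). intros Hw0.
    destruct (orbit_bounded_below e p (G e * v)) as [delta [Hdelta H]]; auto.
    + apply Rmult_lt_compat_l; unfold v; lra.
    + rewrite <- Hwf. apply Hmono; unfold v; lra.
    + now apply bubbly_of_price_bounded_below with delta O.
  - intros [Hw1 Hw2].
    assert (Hm1 : Gd e < ray_mrs (util e) (G e * income_ratio e)) by (rewrite <- Hwf; now apply Hmono).
    assert (Hm2 : ray_mrs (util e) (G e * income_ratio e) < G e) by (rewrite <- Hwb at 2; apply Hmono; lra).
    assert (Hw0 : 0 < income_ratio e) by lra.
    destruct (unique_equilibrium_growing_at_Gd e Hm1 Hw0) as [Ef [HEf Hfund]].
    exists Ef. split; [exact HEf|]. split; [now apply negligible_continuum|].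
    destruct HEf as [[HEf Hgf] Huniq].
    split; [split; [exact HEf|now apply negligible_of_grows_at_Gd]|].
    intros E HE Hn. split.
    + intros Hb ->. now apply (fundamental_not_bubbly e Ef).
    + intros Hne. destruct (negligible_dichotomy e Hm1 Hw0 E HE Hn) as [Hg|Hb]; [|exact Hb].
      destruct Hne. symmetry. now apply Huniq.
Qed.
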